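(* Let $v(n)$, $v_1(n)$, $v_2(n)$ be the numbers of cells turned from OFF to ON at stage $n$ of the eight-neighbor automaton, its first corner version and its second corner version, respectively (defined in the context). Then: $v_1(0)=0$, $v_1(1)=1$, $v_1(2)=3$, $v_1(3)=5$, and for $k\ge2$, $$ v_1(2^k+i)=\begin{cases}(3k+1)2^{k-2}+1, & i=0;\\ 3\cdot2^{k-1}+3, & i=1;\\ 2v_1(i)+v_1(i+1), & i=2,\ldots,2^k-2;\\ 2v_1(i)+v_1(i+1)-1, & i=2^k-1;\end{cases} $$ $v_2(0)=0$, $v_2(1)=1$, and for $k\ge1$, $$ v_2(2^k+i)=\begin{cases}3\cdot2^k-1, & i=0;\\ v_2(i)+2v_1(i+1), & i=1,\ldots,2^k-2;\\ v_2(i)+2v_1(i+1)-2, & i=2^k-1;\end{cases} $$ $v(0)=0$, $v(1)=1$, and for $k\ge1$, $$ v(2^k+i)=\begin{cases}6\cdot2^k-4, & i=0;\\ 4v_2(i), & i=1,\ldots,2^k-1.\end{cases} $$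
   Context: Cells are the unit squares of the square grid; cell $(i,j)\in\mathbb Z\times\mathbb Z$ is the square $\{(x,y): i\le x\le i+1,\ j-1\le y\le j\}$. The neighbors of a cell are the eight cells surrounding it (sharing an edge or a corner). Cells are OFF or ON, and once ON stay ON. Eight-neighbor automaton: at stage $0$ no cell is ON; at stage $1$ a single cell is turned ON; at each stage $n\ge2$ an OFF cell turns ON if and only if exactly one of its eight neighbors was ON after stage $n-1$. First corner version: the third-quadrant cells are the cells $(i,j)$ with $i\le-1$, $j\le0$; at stage $1$ turn ON cell $(0,0)$; thereafter extend by the same eight-neighbor rule, with the proviso that after the first stage no ON cell may be adjacent (among its eight neighbors) to any third-quadrant cell. Second corner version: the same, except that at stage $1$ the cell $(0,1)$ is turned ON. All counts are $0$ at stage $0$. *)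

(* Defs.v *)
From mathcomp Require Import all_boot all_order all_algebra.
From mathcomp Require Import finmap.

Set Implicit Arguments.
Unset Strict Implicit.
Unset Printing Implicit Defensive.

Import Order.TTheory GRing.Theory Num.Theory.
Local Open Scope fset_scope.
Local Open Scope ring_scope.

Notation cell := (int * int)%type.

Definition neighbors (c : cell) : seq cell :=
  let: (i, j) := c in
  [:: (i - 1, j + 1); (i, j + 1); (i + 1, j + 1);
      (i - 1, j);                 (i + 1, j);
      (i - 1, j - 1); (i, j - 1); (i + 1, j - 1)].

(* The set of ON cells is always finite. Only neighbors of ON cells are
   candidates; by in_extend below this restriction loses nothing. *)
Definition extend (allowed : pred cell) (S : {fset cell}) : {fset cell} :=
  S `|` [fset c in flatten [seq neighbors d | d <- S] |
          allowed c && (count (mem S) (neighbors c) == 1%N)].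

Lemma mem_neighborsC (c d : cell) : d \in neighbors c -> c \in neighbors d.
Proof.
case: c => i j; rewrite !inE => H.
by repeat (case/orP: H => [/eqP->|H]); try move/eqP: H => ->;
   rewrite !inE !xpair_eqE ?addrK ?subrK ?eqxx ?orbT.
Qed.

Lemma in_extend (allowed : pred cell) (S : {fset cell}) (c : cell) :
  (c \in extend allowed S) =
  (c \in S) || allowed c && (count (mem S) (neighbors c) == 1%N).
Proof.
rewrite /extend in_fsetU !inE /=; congr (_ || _).
case: (boolP (allowed c && _)) => [/andP[_ /eqP Hc]|_]; last by rewrite andbF.
rewrite andbT; have /hasP[d dc dS] : has (mem S) (neighbors c).
  by rewrite has_count Hc.
by apply/flatten_mapP; exists d => //; apply: mem_neighborsC.
Qed.

(* ON cells after stage n: none at stage 0, the seed alone at stage 1, even if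
   the seed itself is not allowed. *)
Definition on_cells (allowed : pred cell) (seed : cell) (n : nat)
    : {fset cell} :=
  if n is m.+1 then iter m (extend allowed) [fset seed] else fset0.

(* At n = 0 this is 0, since n.-1 = 0. *)
Definition turned_on (allowed : pred cell) (seed : cell) (n : nat) : nat :=
  #|` on_cells allowed seed n `\` on_cells allowed seed n.-1 |.

Definition third_quadrant (c : cell) : bool := (c.1 <= -1) && (c.2 <= 0).

(* Third-quadrant cells are themselves excluded: each has third-quadrant
   neighbors. *)
Definition off_corner (c : cell) : bool := ~~ has third_quadrant (neighbors c).

Definition v (c0 : cell) : nat -> nat := turned_on xpredT c0.
Definition v1 : nat -> nat := turned_on off_corner (0, 0).
Definition v2 : nat -> nat := turned_on off_corner (0, 1).

(* Main.v *)
(** The number of ON neighbors of a cell only grows, so a cell turns ON exactly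
    when the earliest stage T at which one of its neighbors turned ON is the
    stage of a single neighbor.  A function T satisfying this local rule is
    therefore the history of the automaton.

    The histories are self-similar.  They are glued from two patterns: a wedge,
    growing in a half-plane from a seed on its border line, and a quadrant,
    growing from a corner.  The pattern of size 2n consists of the pattern of
    size n and of copies of the two patterns delayed by n or n - 1.  Inside each
    copy the local rule is inherited; along the seams it follows from the
    explicit shape of the borders at stage n (top rows such as .ggg.ggg, in
    which any three consecutive cells contain two ON cells, so that nothing
    grows across them).  The first corner version consists of three half
    wedges, the second one of a quadrant and two half wedges, and the full
    automaton of four quadrants.  Counting the cells of a given stage in the
    doubled patterns yields the recurrences; the boundary cases i = 0, 1 and
    2^k - 1 come from the cells shared by, or missing at the edge of, two
    copies. *)

Require Import Defs.
From mathcomp Require Import all_boot all_order all_algebra.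
From mathcomp Require Import finmap.
From mathcomp Require Import zify.

Set Implicit Arguments.
Unset Strict Implicit.
Unset Printing Implicit Defensive.

Import Order.TTheory GRing.Theory Num.Theory.
Local Open Scope ring_scope.

(** Doubling would be pure transport if the copies agreed wherever they meet. They do not: a copy
    lacks cells that its neighbor puts just across the seam, or would place a cell in the row that
    the wedge excludes. What saves the argument is that only the earliest stages around a cell
    matter, so a disagreement is harmless at a cell with an earlier ON neighbor. The invariants of
    the two patterns therefore record the rows and columns next to the seams. The sizes are
    multiples of 4 because the borders have period 4.

    The corner versions need no analysis of their own: seen from the cell (n - 1, n - 1) of a
    doubled wedge, or from the cell (n, n) of a doubled quadrant, the old pattern fills the
    forbidden third quadrant and the stages from n on replay a corner version.

    The same fact makes the counts close up. If w counts a half wedge and q a quadrant, then v1(s +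
    1) and w(n + s) are both 2 w(s) + w(s + 1), and v2(s) and q(n + s) are both q(s) + 2 w(s), up to
    terms for single cells. *)

Lemma neighborsP (c d : cell) :
  reflect [/\ d <> c, `|d.1 - c.1| <= 1 & `|d.2 - c.2| <= 1] (d \in neighbors c).
Proof.
case: c d => [i j] [k l]; rewrite !inE !xpair_eqE /=.
apply: (iffP idP) => [H|[ne H1 H2]].
  split; [move=> [? ?]|..]; lia.
have : ~ (k = i /\ l = j) by move=> [? ?]; apply: ne; congr pair.
lia.
Qed.

(** A delay has to fix [0], which stands for a cell that never turns ON. *)
Definition sh (m t : nat) : nat := if t == 0%N then 0%N else (m + t)%N.

Lemma shP m t : t = 0%N /\ sh m t = 0%N \/ (0 < t)%N /\ sh m t = (m + t)%N.
Proof. rewrite /sh; case: eqP; lia. Qed.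

Ltac shlia :=
  repeat match goal with H : context [sh _ _] |- _ => revert H end;
  repeat match goal with |- context [sh ?m ?t] =>
    generalize (shP m t); generalize (sh m t); intro end;
  lia.

(* T c is meant as the stage at which c turns ON, with 0 for never.  The rule:
   either the smallest nonzero value of T around c is attained exactly once and
   T c is its successor, or T c = 0 and there is no such unique minimum. *)
Definition good (T : cell -> nat) (c : cell) : bool :=
  let N := neighbors c in
  if T c == 0%N then
    all (fun d => (T d == 0%N) || has (fun e => (e != d) && (0 < T e <= T d)%N) N) N
  else
    has (fun d => [&& (0 < T d)%N, T c == (T d).+1 &
      all (fun e => [|| e == d, T e == 0%N | (T c <= T e)%N]) N]) N.

Lemma good_on (T : cell -> nat) (c : cell) : T c != 0%N ->
  good T c <-> exists d, [/\ d \in neighbors c, (0 < T d)%N, T c = (T d).+1 &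
    forall e, e \in neighbors c -> e <> d -> T e <> 0%N -> (T c <= T e)%N].
Proof.
rewrite /good => /negbTE ->; split.
  case/hasP => d Nd /and3P[Td /eqP Tc /allP H]; exists d; split=> // e Ne ned Te.
  by case/or3P: (H e Ne) => // /eqP.
case=> d [Nd Td Tc H]; apply/hasP; exists d => //; rewrite Td Tc eqxx /=.
apply/allP => e Ne; case: eqP => //= ned; case: eqP => //= Te.
by rewrite -Tc; apply: H.
Qed.

Lemma good_parent (T : cell -> nat) (c : cell) : (1 < T c)%N -> good T c ->
  exists2 d, d \in neighbors c & T c = (T d).+1.
Proof.
by move=> Tc /good_on-/(_ ltac:(lia))[d [Nd _ E _]]; exists d.
Qed.

Lemma good_off (T : cell -> nat) (c : cell) : T c = 0%N ->
  good T c <-> forall d, d \in neighbors c -> (0 < T d)%N ->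
    exists e, [/\ e \in neighbors c, e <> d & (0 < T e <= T d)%N].
Proof.
rewrite /good => ->; split=> [/allP H d Nd Td|H].
  case/orP: (H d Nd) => [/eqP|/hasP[e Ne /andP[/eqP ? ?]]]; first lia.
  by exists e.
apply/allP => d Nd; case: eqP => //= Td; apply/hasP.
have [e [Ne /eqP ed Te]] := H d Nd ltac:(lia).
by exists e => //; rewrite ed.
Qed.

(** An earliest stage attained twice blocks the cell forever; in this form two ON cells of a border
    row stop the growth across it. *)
Lemma good_pair (T : cell -> nat) (c d1 d2 : cell) :
  T c = 0%N -> d1 \in neighbors c -> d2 \in neighbors c -> d1 <> d2 ->
  T d1 = T d2 -> (0 < T d1)%N ->
  (forall e, e \in neighbors c -> T e <> 0%N -> (T d1 <= T e)%N) -> good T c.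
Proof.
move=> Tc N1 N2 ne E P H; apply/good_off => // d Nd Td.
have := H d Nd ltac:(lia).
case: (eqVneq d d1) => [->|/eqP]; [exists d2|exists d1]; split=> //; try lia.
- exact/nesym.
- exact/nesym.
Qed.

(** Meant for cells on an axis of symmetry, with [s] the reflection: no value around the cell has to
    be known. *)
Lemma good_involution (T : cell -> nat) (c : cell) (s : cell -> cell) :
  T c = 0%N ->
  (forall d, d \in neighbors c -> (0 < T d)%N ->
     [/\ s d \in neighbors c, s d <> d & T (s d) = T d]) -> good T c.
Proof.
move=> Tc H; apply/good_off => // d Nd Td.
by have [? ? E] := H d Nd Td; exists (s d); split=> //; rewrite E Td /=.
Qed.

(** * Transport of the local rule *)

Definition motion (f g : cell -> cell) : Prop :=
  [/\ cancel f g, cancel g f,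
      forall c d, d \in neighbors c -> f d \in neighbors (f c) &
      forall c d, d \in neighbors c -> g d \in neighbors (g c)].

Section Transport.
Variables (T T' : cell -> nat) (f g : cell -> cell) (m : nat) (c : cell).
Hypothesis fg : motion f g.
Hypothesis Tc : T' c = sh m (T (f c)).

Let nb_g e : e \in neighbors (f c) -> g e \in neighbors c.
Proof. by case: fg => fK _ _ Hg /Hg; rewrite fK. Qed.

(** The rule only compares positive stages with one another and fixes a difference of one, so it
    survives a motion combined with a common delay. *)
Lemma good_transport :
  (forall d, d \in neighbors c -> T' d = sh m (T (f d))) -> good T (f c) = good T' c.
Proof.
move=> H; have [fK gK Hf Hg] := fg.
have gE e : e \in neighbors (f c) -> T' (g e) = sh m (T e).
  by move=> Ne; rewrite H ?gK ?nb_g.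
case: (eqVneq (T (f c)) 0%N) => [T0|T1].
  have T'0 : T' c = 0%N by rewrite Tc T0.
  apply/idP/idP => [/(good_off T0) G|/(good_off T'0) G].
    apply/good_off => // d Nd; rewrite H // => Td.
    have [e [Ne ed Te]] := G (f d) (Hf _ _ Nd) ltac:(move: Td; shlia).
    exists (g e); split; [exact: nb_g|by move=> E; apply: ed; rewrite -E gK|].
    rewrite gE //; move: Te; shlia.
  apply/good_off => // d Nd Td.
  have [e [Ne ed Te]] := G (g d) (nb_g Nd) ltac:(move: Td; rewrite gE //; shlia).
  exists (f e); split; [exact: Hf|by move=> E; apply: ed; rewrite -E fK|].
  move: Te; rewrite gE // H //; shlia.
have T'1 : T' c != 0%N by move: T1; rewrite Tc; shlia.
apply/idP/idP => [/(good_on T1)|/(good_on T'1)] [d [Nd Td E G]].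
  apply/good_on => //; exists (g d); split; first exact: nb_g.
  - rewrite gE //; move: Td; shlia.
  - rewrite gE // Tc; move: Td E; shlia.
  - move=> e Ne ed; rewrite H // => Te.
    have := G (f e) (Hf _ _ Ne) ltac:(by move=> K; apply: ed; rewrite -K fK)
                    ltac:(move: Te; shlia).
    move: Te; rewrite Tc; shlia.
apply/good_on => //; exists (f d); split; first exact: Hf.
- move: Td; rewrite H //; shlia.
- move: Td E; rewrite H // Tc; shlia.
- move=> e Ne ed Te.
  have := G (g e) (nb_g Ne) ltac:(by move=> K; apply: ed; rewrite -K gK)
                  ltac:(rewrite gE //; move: Te; shlia).
  move: Te; rewrite Tc gE //; shlia.
Qed.

(* Values from w on do not matter at c as soon as some value around c is below
   w; this is what makes the overlaps of the copies harmless. *)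
Lemma good_transport_late (w : nat) (u : cell) :
  u \in neighbors (f c) -> (0 < T u < w)%N ->
  (forall d, d \in neighbors c -> T' d = sh m (T (f d)) \/
     (T (f d) = 0%N \/ (w <= T (f d))%N) /\ (T' d = 0%N \/ (m + w <= T' d)%N)) ->
  good T (f c) -> good T' c.
Proof.
move=> Nu Tu H; have [fK gK Hf Hg] := fg.
have gE e : e \in neighbors (f c) -> (0 < T e < w)%N -> T' (g e) = (m + T e)%N.
  move=> Ne Te; have := H (g e) (nb_g Ne); rewrite gK; shlia.
case: (eqVneq (T (f c)) 0%N) => [T0|T1].
  have T'0 : T' c = 0%N by rewrite Tc T0.
  move=> /(good_off T0) G; apply/good_off => // d Nd Td.
  case: (ltnP (m + T u) (T' d)) => Hd.
    exists (g u); split; first exact: nb_g.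
      by move=> K; move: Hd; rewrite -K gE //; lia.
    rewrite gE //; lia.
  have E : T' d = sh m (T (f d)) by case: (H d Nd) => //; lia.
  have [e [Ne ed Te]] := G (f d) (Hf _ _ Nd) ltac:(move: Td; rewrite E; shlia).
  have Tew : (0 < T e < w)%N by move: Td Hd; rewrite E; shlia.
  exists (g e); split; [exact: nb_g|by move=> K; apply: ed; rewrite -K gK|].
  rewrite gE //; move: Te; rewrite E; shlia.
have T'1 : T' c != 0%N by move: T1; rewrite Tc; shlia.
move=> /(good_on T1) [d [Nd Td E G]].
have Tdw : (0 < T d < w)%N.
  case: (eqVneq u d) => [<-//|/eqP ud]; have := G u Nu ud; lia.
apply/good_on => //; exists (g d); split; first exact: nb_g.
- rewrite gE //; lia.
- rewrite gE // Tc; move: Td E; shlia.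
- move=> e Ne ed Te.
  have := G (f e) (Hf _ _ Ne) ltac:(by move=> K; apply: ed; rewrite -K fK).
  have := H e Ne; move: Te; rewrite Tc; shlia.
Qed.

(** At a cell that stays OFF, a disagreeing value may even equal the one of [u]: the tie already
    prevents a unique minimum. *)
Lemma good_transport_off (u : cell) :
  T (f c) = 0%N -> u \in neighbors (f c) -> (0 < T u)%N ->
  (forall d, d \in neighbors c -> T' d = sh m (T (f d)) \/
     T (f d) = 0%N /\ (m + T u <= T' d)%N) ->
  good T (f c) -> good T' c.
Proof.
move=> T0 Nu Tu H; have [fK gK Hf Hg] := fg.
have gE e : e \in neighbors (f c) -> (0 < T e)%N -> T' (g e) = (m + T e)%N.
  move=> Ne Te; have := H (g e) (nb_g Ne); rewrite gK; shlia.
have T'0 : T' c = 0%N by rewrite Tc T0.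
move=> /(good_off T0) G; apply/good_off => // d Nd Td.
case: (H d Nd) => [E|[Z Hd]].
  have [e [Ne ed Te]] := G (f d) (Hf _ _ Nd) ltac:(move: Td; rewrite E; shlia).
  exists (g e); split; [exact: nb_g|by move=> K; apply: ed; rewrite -K gK|].
  rewrite gE //; move: Te; rewrite ?E; shlia.
exists (g u); split; [exact: nb_g| |rewrite gE //; lia].
by move=> K; move: Z; rewrite -K gK; lia.
Qed.

End Transport.

(** * The wedge pattern and its doubling *)

(* The pattern of size n lives in |x| < n, 0 <= y < n; its row y = 0 is excluded
   from the growth and holds only the seed, at the origin.  The end (n - 1, n - 1)
   of the top row, ON at stage n, is the seed of a rotated wedge that grows
   sideways along the line y = n - 1, and whose rows y <= n are kept; the cell
   (n, n), ON at stage n + 1, is the seed of a wedge growing upwards.  The same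
   happens at the mirror image, whence the absolute values. *)
Definition dbl (n : nat) (T : cell -> nat) (c : cell) : nat :=
  let: (x, y) := c in
  if n%:Z < y then sh n (T (@pair int int ((absz x)%:Z - n%:Z) (y - n%:Z)))
  else if (n <= absz x)%N && (0 < y) then sh n.-1 (T (@pair int int (n%:Z - 1 - y) ((absz x)%:Z + 1 - n%:Z)))
  else T (x, y).

Arguments dbl : simpl never.

(* Fields w_last, w_top, w_prelast describe the border of the pattern, which is
   needed along the seams; w_col1 and w_col2 match the rotated wedge of the next
   doubling with the upward one above it. *)
Record wedge (n : nat) (T : cell -> nat) : Prop := Wedge {
  w_size : (4 <= n)%N && (4 %| n)%N;
  w_sym : forall x y : int, T (- x, y) = T (x, y);
  w_out : forall x y : int, n%:Z <= `|x| \/ y < 0 \/ n%:Z <= y -> T (x, y) = 0%N;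
  w_bot : forall x : int, T (x, 0) = (x == 0);
  w_le : forall x y : int, (T (x, y) <= n)%N;
  w_range : forall x y : int, T (x, y) <> 0%N -> `|x| < (T (x, y))%:Z /\ y < (T (x, y))%:Z;
  w_col0 : forall y : int, 0 < y -> T (0, y) = if y == 1 then 2%N else 0%N;
  w_11 : T (1, 1) = 2%N;
  w_last : forall y : int, T (n%:Z - 1, y) = if y == n%:Z - 1 then n else 0%N;
  w_top : forall x : int, `|x| < n%:Z -> T (x, n%:Z - 1) = if (x %% 4)%Z == 0 then 0%N else n;
  w_prelast : forall y : int, 0 < y < n%:Z - 1 -> (y %% 4)%Z <> 3 -> T (n%:Z - 2, y) = n.-1;
  w_col2 : forall y : int, 0 < y -> T (2, y) = sh 1 (T (y - 1, 1));
  w_col1 : forall c : nat, (2 <= c)%N -> T (1, c%:Z) <> 0%N ->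
    [/\ T (1, c%:Z) = c.+1, T (c%:Z - 2, 1) = c.-1, T (c%:Z - 1, 1) = c,
        T (c%:Z - 1, 2) = c & T (c%:Z, 1) = 0%N];
  w_good : forall x y : int, `|x| < n%:Z -> 0 < y < n%:Z -> good T (x, y) }.

(* Rows are y = 0, ..., 3; columns are |x| = 0, ..., 3. *)
Definition base4 (c : cell) : nat :=
  if 0 <= c.2 then
    nth 0%N (nth [::] [:: [:: 1; 0; 0; 0]; [:: 2; 2; 3; 0]; [:: 0; 0; 3; 0]; [:: 0; 4; 4; 4]]%N
      `|c.2|%N) `|c.1|%N
  else 0%N.

Lemma base4_out x y : 4 <= `|x| \/ y < 0 \/ 4 <= y -> base4 (x, y) = 0%N.
Proof.
rewrite /base4 /=; case: (lerP 0 y) => //= y0 H.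
case: (leqP 4 `|y|%N) => Hy; first by rewrite (nth_default [::]) ?nth_nil.
have Hx : (4 <= `|x|)%N by lia.
by move: `|y|%N Hy => [|[|[|[|]]]] //= _; rewrite nth_default.
Qed.

Ltac small z :=
  let E := fresh in
  assert (E : z = -4 \/ z = -3 \/ z = -2 \/ z = -1 \/ z = 0 \/ z = 1 \/ z = 2 \/ z = 3 \/ z = 4) by lia;
  repeat (destruct E as [E|E]; [subst z|]); try subst z.

Lemma base4_wedge : wedge 4 base4.
Proof.
have in_or_out x y : (`|x| < 4 /\ 0 <= y < 4) \/ base4 (x, y) = 0%N.
  case: (boolP ((`|x| < 4) && (0 <= y < 4))) => [|H]; [lia|right].
  apply: base4_out; lia.
split.
- by [].
- by move=> x y; rewrite /base4 /= abszN.
- exact: base4_out.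
- move=> x; case: (ltrP `|x| 4) => H; first by small x.
  rewrite base4_out; [lia|by left].
- by move=> x y; case: (in_or_out x y) => [[Hx Hy]|-> //]; small x; small y.
- by move=> x y; case: (in_or_out x y) => [[Hx Hy]|-> //]; small x; small y.
- move=> y y0; case: (ltrP y 4) => H; first by small y => //; lia.
  rewrite base4_out; [case: eqP => //; lia|lia].
- by [].
- move=> y; case: (boolP (0 <= y < 4)) => H; first by small y.
  rewrite base4_out; [case: eqP => //; lia|lia].
- by move=> x Hx; small x.
- move=> y Hy _; have [] : y = 1 \/ y = 2 by lia.
    by move->.
  by move->.
- move=> y y0; case: (ltrP y 5) => H; first by small y => //; lia.
  rewrite !base4_out //; lia.
- case=> [|[|[|[|c]]]] // _; rewrite base4_out //; lia.
- by move=> x y Hx Hy; small x; small y; try lia; vm_compute.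
Qed.

(** * Adjacency and motions of the grid *)

Lemma pair_neq (x y x' y' : int) : (x', y') <> (x, y) <-> x' <> x \/ y' <> y.
Proof.
split=> [H|H [E1 E2]]; last by case: H.
by case: (eqVneq x' x) => [E|/eqP]; [right=> E'; apply: H; rewrite E E'|left].
Qed.

Lemma neighbors_pairP (x y x' y' : int) :
  (x', y') \in neighbors (x, y) <->
  (x' <> x \/ y' <> y) /\ `|x' - x| <= 1 /\ `|y' - y| <= 1.
Proof.
rewrite -pair_neq; split=> [/neighborsP[]//|[? [? ?]]].
by apply/neighborsP.
Qed.

Lemma motionI (f g : cell -> cell) :
  (forall x y, g (f (x, y)) = (x, y)) -> (forall x y, f (g (x, y)) = (x, y)) ->
  (forall x y x' y', (`|(f (x, y)).1 - (f (x', y')).1| <= 1 /\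
                      `|(f (x, y)).2 - (f (x', y')).2| <= 1) <->
                     (`|x - x'| <= 1 /\ `|y - y'| <= 1)) -> motion f g.
Proof.
move=> fK gK H.
have iso c d : (`|(f d).1 - (f c).1| <= 1 /\ `|(f d).2 - (f c).2| <= 1) <->
    (`|d.1 - c.1| <= 1 /\ `|d.2 - c.2| <= 1).
  by case: c d => [x y] [x' y']; apply: H.
have {}fK : cancel f g by case.
have {}gK : cancel g f by case.
split=> // c d /neighborsP[ne H1 H2]; apply/neighborsP.
  have [? ?] : `|(f d).1 - (f c).1| <= 1 /\ `|(f d).2 - (f c).2| <= 1 by apply/iso.
  by split=> // /(can_inj fK).
have [? ?] : `|(g d).1 - (g c).1| <= 1 /\ `|(g d).2 - (g c).2| <= 1.
  by apply/iso; rewrite !gK.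
by split=> // /(can_inj gK).
Qed.

Lemma motion_translation (a b : int) :
  motion (fun c => (c.1 + a, c.2 + b)) (fun c => (c.1 - a, c.2 - b)).
Proof.
apply: motionI => [x y|x y|x y x' y'] /=; [| |lia]; congr pair; lia.
Qed.

Lemma motion_reflection : motion (fun c => (- c.1, c.2)) (fun c => (- c.1, c.2)).
Proof.
apply: motionI => [x y|x y|x y x' y'] /=; [| |lia]; congr pair; lia.
Qed.

Lemma motion_rotation (a b : int) :
  motion (fun c => (a - c.2, c.1 + b)) (fun c => (c.2 - b, a - c.1)).
Proof.
apply: motionI => [x y|x y|x y x' y'] /=; [| |lia]; congr pair; lia.
Qed.

Lemma motion_diagonal (b : int) :
  motion (fun c => (c.2 + b, c.1 - b)) (fun c => (c.2 + b, c.1 - b)).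
Proof.
apply: motionI => [x y|x y|x y x' y'] /=; [| |lia]; congr pair; lia.
Qed.

Lemma motion_id : motion id id.
Proof. by split. Qed.

Lemma dbl_up (n : nat) (T : cell -> nat) (x y : int) : n%:Z < y -> dbl n T (x, y) = sh n (T (@pair int int ((absz x)%:Z - n%:Z) (y - n%:Z))).
Proof. by rewrite /dbl => ->. Qed.

Lemma dbl_side (n : nat) (T : cell -> nat) (x y : int) : n%:Z <= `|x| -> 0 < y <= n%:Z ->
  dbl n T (x, y) = sh n.-1 (T (@pair int int (n%:Z - 1 - y) ((absz x)%:Z + 1 - n%:Z))).
Proof.
by move=> Hx Hy; rewrite /dbl; case: ifP; first lia; case: ifP => //; lia.
Qed.

Lemma dbl_in (n : nat) (T : cell -> nat) (x y : int) : `|x| < n%:Z \/ y <= 0 -> y <= n%:Z -> dbl n T (x, y) = T (x, y).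
Proof. rewrite /dbl => H K; case: ifP; first lia; case: ifP => //; lia. Qed.

(** * Borders of the doubled wedge *)

Section Doubling.
Variables (n : nat) (T : cell -> nat).
Hypothesis W : wedge n T.
Local Notation U := (dbl n T).

Let n4 : (4 <= n)%N. Proof. by case/andP: (w_size W). Qed.
Let n4m : (n%:Z %% 4)%Z = 0. Proof. case/andP: (w_size W); lia. Qed.
Let TE (x y x' y' : int) : x = x' -> y = y' -> T (x, y) = T (x', y'). Proof. by move=> -> ->. Qed.

Lemma dbl_sym (x y : int) : U (- x, y) = U (x, y).
Proof. by rewrite /dbl abszN (w_sym W). Qed.

Lemma dbl_out (x y : int) :
  (2 * n)%N%:Z <= `|x| \/ y < 0 \/ (2 * n)%N%:Z <= y -> U (x, y) = 0%N.
Proof.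
move=> H; rewrite /dbl; case: ifP => Hy; last case: ifP => Hx;
  rewrite (w_out W) //; lia.
Qed.

Lemma dbl_le (x y : int) : (U (x, y) <= 2 * n)%N.
Proof.
have H a b := w_le W a b.
rewrite /dbl; case: ifP => Hy; last case: ifP => Hx.
- have := H ((absz x)%:Z - n%:Z) (y - n%:Z); shlia.
- have := H (n%:Z - 1 - y) ((absz x)%:Z + 1 - n%:Z); shlia.
- have := H x y; lia.
Qed.

Lemma dbl_range (x y : int) : U (x, y) <> 0%N ->
  `|x| < (U (x, y))%:Z /\ y < (U (x, y))%:Z.
Proof.
have H a b := @w_range _ _ W a b.
rewrite /dbl; case: ifP => Hy; last case: ifP => Hx.
- have := H ((absz x)%:Z - n%:Z) (y - n%:Z); shlia.
- have := H (n%:Z - 1 - y) ((absz x)%:Z + 1 - n%:Z); shlia.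
- exact: H.
Qed.

Lemma dbl_col0 (y : int) : 0 < y -> U (0, y) = if y == 1 then 2%N else 0%N.
Proof.
move=> y0; case: (lerP y n%:Z) => Hy.
  rewrite dbl_in ?(w_col0 W) //; lia.
rewrite dbl_up // (w_out W); last lia.
by case: eqP => //; lia.
Qed.

Lemma dbl_last (y : int) :
  U ((2 * n)%N%:Z - 1, y) = if y == (2 * n)%N%:Z - 1 then (2 * n)%N else 0%N.
Proof.
case: (lerP y n%:Z) => Hy.
  case: eqP => [?|_]; first lia.
  case: (lerP y 0) => y0; first by rewrite dbl_in ?(w_out W) //; lia.
  rewrite dbl_side ?(w_out W) //; lia.
rewrite dbl_up // (TE (x' := n%:Z - 1) (y' := y - n%:Z)) //; last lia.
rewrite (w_last W); case: eqP => ?; case: eqP => ? //; try lia.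
shlia.
Qed.

Lemma dbl_top (x : int) : `|x| < (2 * n)%N%:Z ->
  U (x, (2 * n)%N%:Z - 1) = if (x %% 4)%Z == 0 then 0%N else (2 * n)%N.
Proof.
move=> Hx; rewrite dbl_up; last lia.
rewrite (TE (x' := `|x| - n%:Z) (y' := n%:Z - 1)) //; last lia.
case: (ltrP `|(absz x)%:Z - n%:Z| n%:Z) => H; last first.
  (* Only [x = 0] lies outside both upward wedges, and there the period predicts an empty cell
     too. *)
  rewrite (w_out W); last by left.
  case: eqP => //; lia.
by rewrite (w_top W) //; case: eqP; case: eqP => //=; try lia; shlia.
Qed.

Lemma dbl_prelast (y : int) : 0 < y < (2 * n)%N%:Z - 1 -> (y %% 4)%Z <> 3 ->
  U ((2 * n)%N%:Z - 2, y) = (2 * n).-1.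
Proof.
move=> Hy Hm; case: (lerP y n%:Z) => Hn.
  rewrite dbl_side; [|lia|lia].
  rewrite (TE (x' := n%:Z - 1 - y) (y' := n%:Z - 1)) //; last lia.
  rewrite (w_top W); last lia.
  case: eqP; first lia; shlia.
rewrite dbl_up // (TE (x' := n%:Z - 2) (y' := y - n%:Z)) //; last lia.
rewrite (w_prelast W); [shlia|lia|lia].
Qed.

(** Above height [n], column 2 is the column [n - 2] of an upward wedge and the matching part of row
    1 is the same column of a rotated one; their delays [n] and [n - 1] differ by one. *)
Lemma dbl_col2 (y : int) : 0 < y -> U (2, y) = sh 1 (U (y - 1, 1)).
Proof.
move=> y0; case: (lerP y n%:Z) => Hn.
  rewrite !dbl_in ?(w_col2 W) //; lia.
rewrite dbl_up // dbl_side; [|lia|lia].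
rewrite (TE (x' := - (n%:Z - 2)) (y' := y - n%:Z)) //; last lia.
rewrite (w_sym W) (TE (x := n%:Z - 1 - 1) (x' := n%:Z - 2) (y' := y - n%:Z)) //; try lia.
shlia.
Qed.

(** Above height [n], column 1 is the last column of an upward wedge, so each doubling adds the
    single height [2 * n - 1]; the values required near it in rows 1 and 2 come from the upper
    corner of the rotated wedge. *)
Lemma dbl_col1 (c : nat) : (2 <= c)%N -> U (1, c%:Z) <> 0%N ->
    [/\ U (1, c%:Z) = c.+1, U (c%:Z - 2, 1) = c.-1, U (c%:Z - 1, 1) = c,
        U (c%:Z - 1, 2) = c & U (c%:Z, 1) = 0%N].
Proof.
move=> c2; case: (ltnP c n) => Hc.
  rewrite !dbl_in; try lia; exact: (w_col1 W).
case: (eqVneq c n) => [->|ne].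
  rewrite dbl_in; [|lia|lia].
  rewrite (w_out W) //; lia.
rewrite {1 2}dbl_up; last lia.
rewrite (TE (x' := - (n%:Z - 1)) (y' := c%:Z - n%:Z)) //; last lia.
rewrite (w_sym W) (w_last W); case: eqP => // E _.
have {E}-> : c = (2 * n - 1)%N by lia.
split; first shlia.
- rewrite dbl_side; [|lia|lia].
  rewrite (TE (x' := n%:Z - 2) (y' := n%:Z - 2)); try lia.
  rewrite (w_prelast W); [shlia|lia|lia].
- rewrite dbl_side; [|lia|lia].
  rewrite (TE (x' := n%:Z - 2) (y' := n%:Z - 1)); try lia.
  rewrite (w_top W); last lia.
  case: eqP; first lia; shlia.
- rewrite dbl_side; [|lia|lia].
  rewrite (TE (x' := n%:Z - 3) (y' := n%:Z - 1)); try lia.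
  rewrite (w_top W); last lia.
  case: eqP; first lia; shlia.
- have -> : (2 * n - 1)%N%:Z = (2 * n)%N%:Z - 1 by lia.
  rewrite dbl_last; case: eqP => //; lia.
Qed.

End Doubling.

(** * The local rule in the doubled wedge *)

Section DoublingGood.
Variables (n : nat) (T : cell -> nat).
Hypothesis W : wedge n T.
Local Notation U := (dbl n T).

Let n4 : (4 <= n)%N. Proof. by case/andP: (w_size W). Qed.
Let n4m : (n%:Z %% 4)%Z = 0. Proof. case/andP: (w_size W); lia. Qed.
Let TE (x y x' y' : int) : x = x' -> y = y' -> T (x, y) = T (x', y'). Proof. by move=> -> ->. Qed.
Let TN (x y x' : int) : x = - x' -> T (x, y) = T (x', y). Proof. by move=> ->; apply: (w_sym W). Qed.
(** Hence a copy delayed by [n - 1] adds nothing above its bottom row before stage [n + 1], when the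
    old pattern is complete. *)
Let T2 (c : cell) : 0 < c.2 -> T c <> 0%N -> (2 <= T c)%N.
Proof. by case: c => x y /= y0 K; have := w_range W K; lia. Qed.

Local Ltac late_value :=
  match goal with |- context [sh _ (T ?c)] =>
    generalize (@T2 c ltac:(simpl; lia)); shlia end.

Lemma dbl_good_low (x y : int) : 0 <= x < n%:Z -> 0 < y < n%:Z -> good U (x, y).
Proof.
move=> Hx Hy.
have Ux : U (x, y) = sh 0 (T (x, y)) by rewrite dbl_in; [shlia|lia|lia].
have G : good T (x, y) by apply: (w_good W); lia.
have E (x' y' : int) : `|x'| < n%:Z \/ y' <= 0 -> y' <= n%:Z -> U (x', y') = sh 0 (T (x', y')).
  by move=> ? ?; rewrite dbl_in //; shlia.
case: (ltrP x (n%:Z - 1)) => Hx1.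
  rewrite -(good_transport (T := T) (m := 0) motion_id Ux) // => -[x' y'] /neighbors_pairP N.
  by apply: E; lia.
have {Hx Hx1} Ex : x = n%:Z - 1 by lia.
(* Column [n - 2] supplies a neighbor of stage [n - 1], whereas the rotated wedge enters column [n]
   only from stage [n + 1] on; hence [w := n.+1] below. *)
have [u Nu Tu] : exists2 u, u \in neighbors (x, y) & T u = n.-1.
  have [y' [? ? ?]] : exists y' : int, [/\ `|y' - y| <= 1, 0 < y' < n%:Z - 1 & (y' %% 4)%Z <> 3].
    case: (eqVneq y (n%:Z - 1)) => [->|?]; first by exists (n%:Z - 2); split; lia.
    case: (eqVneq (y %% 4)%Z 3) => [?|/eqP ?]; last by exists y; split; lia.
    by exists (y - 1); split; lia.
  exists (n%:Z - 2, y'); last by rewrite (w_prelast W).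
  by apply/neighbors_pairP; lia.
apply: (good_transport_late (w := n.+1) motion_id Ux Nu) => //.
  lia.
move=> [x' y'] /neighbors_pairP N.
case: (lerP n%:Z x') => Hx'; last by left; apply: E; lia.
case: (lerP y' 0) => Hy'; first by left; apply: E; lia.
right; split; first by left; apply: (w_out W); lia.
rewrite dbl_side; [|lia|lia].
have -> : T (@pair int int (n%:Z - 1 - y') (`|x'|%N%:Z + 1 - n%:Z)) = T (n%:Z - 1 - y', 1).
  by apply: TE; lia.
late_value.
Qed.

Lemma dbl_good_mid (x : int) : 0 <= x < n%:Z -> good U (x, n%:Z).
Proof.
move=> Hx.
have [a [b [Na Nb ne Ta Tb]]] : exists a b : int, [/\ `|a - x| <= 1, `|b - x| <= 1, a <> b,
    `|a| < n%:Z /\ (a %% 4)%Z <> 0 & `|b| < n%:Z /\ (b %% 4)%Z <> 0].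
  have : (x %% 4)%Z = 0 \/ (x %% 4)%Z = 1 \/ (x %% 4)%Z = 2 \/ (x %% 4)%Z = 3 by lia.
  case=> [H|[H|[H|H]]].
  - by exists (x - 1), (x + 1); split; lia.
  - by exists x, (x + 1); split; lia.
  - by exists (x - 1), x; split; lia.
  - by exists (x - 1), x; split; lia.
have top (z : int) : `|z| < n%:Z /\ (z %% 4)%Z <> 0 -> U (z, n%:Z - 1) = n.
  move=> [? /eqP/negbTE Hz]; rewrite dbl_in; [|lia|lia].
  by rewrite (w_top W) // Hz.
apply: (good_pair (d1 := (a, n%:Z - 1)) (d2 := (b, n%:Z - 1))).
- rewrite dbl_in; [|lia|lia]; apply: (w_out W); lia.
- by apply/neighbors_pairP; lia.
- by apply/neighbors_pairP; lia.
- by apply/pair_neq; left.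
- by rewrite !top.
- by rewrite top //; lia.
- move=> [x' y'] /neighbors_pairP N; rewrite top //.
  case: (ltrP n%:Z y') => Hy.
    rewrite dbl_up //; shlia.
  case: (ltrP `|x'| n%:Z) => Hx'.
    rewrite dbl_in; [|lia|lia].
    case: (eqVneq y' n%:Z) => [->|ny]; first by rewrite (w_out W) //; lia.
    have -> : y' = n%:Z - 1 by lia.
    by rewrite (w_top W) //; case: eqP.
  rewrite dbl_side; [|lia|lia].
  late_value.
Qed.

Lemma dbl_good_axis (y : int) : n%:Z < y < (2 * n)%N%:Z -> good U (0, y).
Proof.
move=> Hy.
have col0 (y' : int) : 1 < y' -> U (0, y') = 0%N.
  by move=> ?; rewrite (dbl_col0 W); [case: eqP => //; lia|lia].
apply: (good_involution (s := fun c => (- c.1, c.2))); first by apply: col0; lia.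
move=> [x' y'] /neighbors_pairP N /= Ux; split.
- by apply/neighbors_pairP; lia.
- apply/pair_neq; left.
  case: (eqVneq x' 0) => [x0|]; last lia.
  by move: Ux; rewrite x0 col0 //; lia.
- exact: (dbl_sym W).
Qed.

(* The last case analysis concerns the cells in row n + 1: for them the isolated
   ON cells (n + c - 1, n) of the rotated wedge are extra, late neighbors. *)
Lemma dbl_good_up (x y : int) : 0 < x < (2 * n)%N%:Z -> n%:Z < y < (2 * n)%N%:Z ->
  good U (x, y).
Proof.
move=> Hx Hy.
pose f (c : cell) : cell := (c.1 + - n%:Z, c.2 + - n%:Z).
pose g (c : cell) : cell := (c.1 - - n%:Z, c.2 - - n%:Z).
have M : motion f g by apply: motion_translation.
have E (x' y' : int) : 0 <= x' -> n%:Z < y' -> U (x', y') = sh n (T (f (x', y'))).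
  move=> ? ?; rewrite dbl_up //; congr (sh _ _); apply: TE => /=; lia.
have Uxy : U (x, y) = sh n (T (f (x, y))) by apply: E; lia.
have G : good T (f (x, y)) by apply: (w_good W) => /=; lia.
have fE (x' y' : int) : T (f (x', y')) = T (x' - n%:Z, y' - n%:Z) by apply: TE.
(* In row [n] the upward copy expects its bottom row, which holds the seed alone, but finds column 1
   of the rotated wedge. The cell [(1, 1)] of that column matches the seed; its other ON cells are
   the exceptions. *)
have F (x' : int) : 0 <= x' -> (x' <= n%:Z \/ T (1, x' + 1 - n%:Z) = 0%N) ->
    U (x', n%:Z) = sh n (T (f (x', n%:Z))).
  move=> x0 H; rewrite fE (TE (x' := x' - n%:Z) (y' := 0)); try lia.
  rewrite (w_bot W); case: (ltrP x' n%:Z) => Hn.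
    rewrite dbl_in; [|lia|lia].
    rewrite (w_out W); last lia.
    by case: eqP => //; lia.
  rewrite dbl_side; [|lia|lia].
  rewrite (@TN _ _ 1); last lia.
  case: (eqVneq x' n%:Z) => [->|ne].
    rewrite (TE (x' := 1) (y' := 1)); try lia.
    by rewrite (w_11 W) subrr eqxx; shlia.
  have -> : (x' - n%:Z == 0) = false by apply/eqP; lia.
  case: H => [|H]; first lia.
  rewrite (TE (x' := 1) (y' := x' + 1 - n%:Z)); try lia.
  by rewrite H.
have Late (c : nat) : (2 <= c)%N -> T (1, c%:Z) <> 0%N ->
    T (f (n%:Z + c%:Z - 1, n%:Z)) = 0%N /\ U (n%:Z + c%:Z - 1, n%:Z) = (n + c)%N.
  move=> c2 Tc; have [Tc1 _ _ _ _] := w_col1 W c2 Tc; split.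
    rewrite fE (TE (x' := c%:Z - 1) (y' := 0)); try lia.
    rewrite (w_bot W); case: eqP => //; lia.
  rewrite dbl_side; [|lia|lia].
  rewrite (@TN _ _ 1); last lia.
  rewrite (TE (x' := 1) (y' := c%:Z)) ?Tc1; [shlia|lia|lia].
have NL (x' : int) : n%:Z < x' -> T (1, x' + 1 - n%:Z) <> 0%N -> exists c : nat,
   [/\ (2 <= c)%N, x' = n%:Z + c%:Z - 1 & T (1, c%:Z) <> 0%N].
  move=> Hx' H; exists (absz (x' + 1 - n%:Z)%R); split; [lia|lia|].
  by move=> K; apply: H; rewrite -K; apply: TE; lia.
case: (boolP [exists i : 'I_3, let x' := x + i%:Z - 1 in
    [&& y == n%:Z + 1, n%:Z < x' & T (1, x' + 1 - n%:Z) != 0%N]]); last first.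
  move=> /existsPn H.
  rewrite -(good_transport M Uxy) // => -[x' y'] /neighbors_pairP N.
  case: (ltrP n%:Z y') => Hy'; first by apply: E; lia.
  have -> : y' = n%:Z by lia.
  apply: F; first lia.
  have Hi : (absz (x' - x + 1)%R < 3)%N by lia.
  have := H (Ordinal Hi); rewrite /=.
  have -> : x + (absz (x' - x + 1))%:Z - 1 = x' by lia.
  case: (lerP x' n%:Z) => [|Hx' K]; first by left.
  right; apply/eqP; move: K; rewrite /=.
  by case: eqP => [_|]; [rewrite /= negbK|lia].
case/existsP => i /and3P[/eqP Ey Hn /eqP /(NL _ Hn)[c [c2 Ex Tc]]].
have [Tc1 Ta Tb Tb2 Tz] := w_col1 W c2 Tc.
have Hi : (i < 3)%N by [].
have {}Hi : x - n%:Z = c%:Z - 2 \/ x - n%:Z = c%:Z - 1 \/ x - n%:Z = c%:Z by lia.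
have fxy : T (f (x, y)) = T (x - n%:Z, 1) by rewrite fE; apply: TE; lia.
have nbE (x' y' : int) : (x', y') \in neighbors (f (x, y)) <->
     (x' <> x - n%:Z \/ y' <> 1) /\ `|x' - (x - n%:Z)| <= 1 /\ `|y' - 1| <= 1.
  rewrite /f /=; split=> [/neighbors_pairP|H]; first lia.
  by apply/neighbors_pairP; lia.
have nbr (w : nat) : (w <= c)%N ->
    (forall c' : nat, (2 <= c')%N -> T (1, c'%:Z) <> 0%N ->
        `|n%:Z + c'%:Z - 1 - x| <= 1 -> (w <= c')%N) ->
    forall d, d \in neighbors (x, y) -> U d = sh n (T (f d)) \/
      T (f d) = 0%N /\ (n + w <= U d)%N.
  move=> wc H [x' y'] /neighbors_pairP N.
  case: (ltrP n%:Z y') => Hy'; first by left; apply: E; lia.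
  have -> : y' = n%:Z by lia.
  case: (lerP x' n%:Z) => Hx'; first by left; apply: F; [lia|left].
  case: (eqVneq (T (1, x' + 1 - n%:Z)) 0%N) => [K|/eqP K].
    by left; apply: F; [lia|right].
  have [c' [c'2 Ex' Tc']] := NL _ Hx' K.
  have [L1 L2] := Late c' c'2 Tc'.
  by right; rewrite Ex' L1 L2; split=> //; rewrite leq_add2l; apply: H => //; lia.
(* This excludes earlier exceptions nearby: row 1 is empty at [c'], but not at [c - 2] and
   [c - 1]. *)
have low (c' : nat) : (2 <= c')%N -> T (1, c'%:Z) <> 0%N -> T (c'%:Z, 1) = 0%N.
  by move=> H1 H2; have [] := w_col1 W H1 H2.
(* In the copy the exception sits at [(c - 1, 0)] with value [c]. This is too late for the cells
   [c - 2] and [c - 1] of row 1, which have a neighbor of value below [c], and a mere tie at the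
   cell [c], which stays OFF. *)
case: Hi => [Hi|[Hi|Hi]].
- have Tx : T (f (x, y)) = c.-1 by rewrite fxy -Ta; apply: TE.
  have c3 : (2 < c)%N.
    rewrite ltn_neqAle c2 andbT; apply/eqP => K; move: Ta Tb; rewrite -K /=.
    rewrite (TE (x' := 0) (y' := 1)) // (w_col0 W) //.
  have Tx1 : (1 < T (f (x, y)))%N by rewrite Tx; lia.
  have [u Nu Eu] := good_parent Tx1 G.
  apply: (good_transport_late (w := c) (u := u) M Uxy Nu) => //; first lia.
  move=> d Nd; case: (nbr c (leqnn c) _ d Nd); [|by left|by move=> [? ?]; right; split; [left|right]].
  move=> c' H1 H2 H3.
  have := low c' H1 H2; have [K|[K|K]] : c' = (c - 2)%N \/ c' = (c - 1)%N \/ (c <= c')%N by lia.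
  + rewrite (TE (x' := c%:Z - 2) (y' := 1)) ?Ta; lia.
  + rewrite (TE (x' := c%:Z - 1) (y' := 1)) ?Tb; lia.
  + by [].
- have Tx : T (f (x, y)) = c by rewrite fxy -Tb; apply: TE.
  apply: (good_transport_late (w := c) (u := (c%:Z - 2, 1)) M Uxy) => //.
  + by apply/nbE; lia.
  + rewrite Ta; lia.
  + move=> d Nd; case: (nbr c (leqnn c) _ d Nd); [|by left|by move=> [? ?]; right; split; [left|right]].
    move=> c' H1 H2 H3.
    have := low c' H1 H2; have [K|K] : c' = (c - 1)%N \/ (c <= c')%N by lia.
    * rewrite (TE (x' := c%:Z - 1) (y' := 1)) ?Tb; lia.
    * by [].
- apply: (good_transport_off (u := (c%:Z - 1, 1)) M Uxy) => //.
  + by rewrite fxy -Tz; apply: TE.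
  + by apply/nbE; lia.
  + by rewrite Tb; lia.
  + rewrite Tb; apply: nbr => // c' H1 H2 H3; lia.
Qed.

Lemma dbl_good_side (x y : int) : n%:Z <= x < (2 * n)%N%:Z - 1 -> 0 < y <= n%:Z ->
  good U (x, y).
Proof.
move=> Hx Hy.
pose f (c : cell) : cell := (n%:Z - 1 - c.2, c.1 + (1 - n%:Z)).
pose g (c : cell) : cell := (c.2 - (1 - n%:Z), n%:Z - 1 - c.1).
have M : motion f g by apply: motion_rotation.
have fE (x' y' : int) : T (f (x', y')) = T (n%:Z - 1 - y', x' + 1 - n%:Z) by apply: TE => /=; lia.
have E (x' y' : int) : n%:Z <= x' -> 0 < y' <= n%:Z -> U (x', y') = sh n.-1 (T (f (x', y'))).
  move=> ? ?; rewrite fE dbl_side; [|lia|lia].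
  by congr (sh _ _); apply: TE => //; lia.
have Uxy : U (x, y) = sh n.-1 (T (f (x, y))) by apply: E; lia.
have G : good T (f (x, y)) by apply: (w_good W) => /=; lia.
have nbE (x' y' : int) : (x', y') \in neighbors (f (x, y)) <->
     (x' <> n%:Z - 1 - y \/ y' <> x + 1 - n%:Z) /\ `|x' - (n%:Z - 1 - y)| <= 1
     /\ `|y' - (x + 1 - n%:Z)| <= 1.
  rewrite /f /=; split=> [/neighbors_pairP|H]; first lia.
  by apply/neighbors_pairP; lia.
have L (y' : int) : y' <= n%:Z -> U (n%:Z - 1, y') = sh n.-1 (T (f (n%:Z - 1, y'))).
  move=> Hy'; rewrite fE dbl_in; [|lia|lia].
  rewrite (TE (x := n%:Z - 1 - y') (x' := n%:Z - 1 - y') (y' := 0)) //; last lia.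
  rewrite (w_bot W) (w_last W).
  have -> : (n%:Z - 1 - y' == 0) = (y' == n%:Z - 1) by apply/eqP/eqP; lia.
  case: eqP => _; shlia.
(* Row [n + 1] already belongs to the upward wedge; [w_col2] makes its row 1 agree with column 2 of
   the rotated wedge. *)
have Up (x' : int) : n%:Z <= x' -> U (x', n%:Z + 1) = sh n.-1 (T (f (x', n%:Z + 1))).
  move=> Hx'; rewrite fE (@TN _ _ 2); last lia.
  rewrite (w_col2 W); last lia.
  rewrite dbl_up; last lia.
  rewrite (TE (x' := x' - n%:Z) (y' := 1)); try lia.
  rewrite (TE (x := x' + 1 - n%:Z - 1) (x' := x' - n%:Z) (y' := 1)); try lia.
  shlia.
have Low (x' : int) : n%:Z <= x' -> x' <> (2 * n)%N%:Z - 2 -> U (x', 0) = sh n.-1 (T (f (x', 0))).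
  move=> Hx' ne; rewrite fE (TE (x' := n%:Z - 1) (y' := x' + 1 - n%:Z)) //; last lia.
  rewrite (w_last W) dbl_in; [|lia|lia].
  rewrite (w_bot W); case: eqP; case: eqP; try lia.
  by [].
(* Next to [(n, n)], the cell [(n - 1, n + 1)] follows the upward wedge: it turns ON at stage
   [n + 2], after the seed of the rotated wedge. *)
case: (boolP ((x == n%:Z) && (y == n%:Z))) => [/andP[/eqP Ex /eqP Ey]|corner].
  apply: (good_transport_late (w := 3) (u := (0, 0)) M Uxy) => //.
  - by apply/nbE; lia.
  - by rewrite (w_bot W).
  - move=> [x' y'] /neighbors_pairP N.
    case: (lerP n%:Z x') => Hx'.
      left; case: (lerP y' n%:Z) => Hy'; first by apply: E; lia.
      have -> : y' = n%:Z + 1 by lia.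
      by apply: Up; lia.
    have -> : x' = n%:Z - 1 by lia.
    case: (lerP y' n%:Z) => Hy'; first by left; apply: L; lia.
    right; split.
      left; rewrite fE (TE (x' := n%:Z - 1 - y') (y' := 0)) //; last lia.
      by rewrite (w_bot W); case: eqP => //; lia.
    right; rewrite dbl_up //.
    rewrite (@TN _ _ 1); last lia.
    rewrite (TE (x' := 1) (y' := 1)) ?(w_11 W); [shlia|by []|lia].
have L' (x' y' : int) : (x', y') \in neighbors (x, y) -> x' < n%:Z ->
    U (x', y') = sh n.-1 (T (f (x', y'))).
  move=> /neighbors_pairP N Hx'.
  have -> : x' = n%:Z - 1 by lia.
  by apply: L; lia.
have K (x' y' : int) : (x', y') \in neighbors (x, y) -> 0 < y' ->
    U (x', y') = sh n.-1 (T (f (x', y'))).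
  move=> N; case: (ltrP x' n%:Z) => Hx'; first by move=> _; apply: L'.
  move/neighbors_pairP: N => N y0.
  case: (lerP y' n%:Z) => Hy'; first by apply: E; lia.
  have -> : y' = n%:Z + 1 by lia.
  by apply: Up; lia.
(* The rotated copy would put its end cell at [(2 * n - 2, 0)], in the excluded row. The missing
   stage [2 * n - 1] is not felt in row 1, where a neighbor of stage [2 * n - 2] comes first. *)
case: (boolP ((y == 1) && ((2 * n)%N%:Z - 3 <= x))) => [/andP[/eqP Ey Ex]|edge].
  apply: (good_transport_late (w := n) (u := (n%:Z - 2, x - n%:Z)) M Uxy) => //.
  - by apply/nbE; lia.
  - by rewrite (w_prelast W); lia.
  - move=> [x' y'] N.
    case: (ltrP 0 y') => Hy'; first by left; apply: K.
    case: (ltrP x' n%:Z) => Hx'; first by left; apply: L'.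
    move/neighbors_pairP: N => N.
    have -> : y' = 0 by lia.
    case: (eqVneq x' ((2 * n)%N%:Z - 2)) => [->|/eqP ?]; last by left; apply: Low.
    right; split.
      right; rewrite fE (TE (x' := n%:Z - 1) (y' := n%:Z - 1)); try lia.
      by rewrite (w_last W) eqxx.
    left; rewrite dbl_in ?(w_bot W); [|lia|lia].
    by case: eqP => //; lia.
rewrite -(good_transport M Uxy) // => -[x' y'] N.
case: (ltrP 0 y') => Hy'; first by apply: K.
case: (ltrP x' n%:Z) => Hx'; first by apply: L'.
move/neighbors_pairP: N => N.
have -> : y' = 0 by lia.
by apply: Low; lia.
Qed.

Lemma dbl_good_edge (y : int) : 0 < y <= n%:Z -> good U ((2 * n)%N%:Z - 1, y).
Proof.
move=> Hy.
have [a [b [Na Nb ne Ta Tb]]] : exists a b : int, [/\ `|a - y| <= 1, `|b - y| <= 1, a <> b,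
    0 < a < (2 * n)%N%:Z - 1 /\ (a %% 4)%Z <> 3 & 0 < b < (2 * n)%N%:Z - 1 /\ (b %% 4)%Z <> 3].
  have : (y %% 4)%Z = 0 \/ (y %% 4)%Z = 1 \/ (y %% 4)%Z = 2 \/ (y %% 4)%Z = 3 by lia.
  case=> [H|[H|[H|H]]].
  - by exists y, (y + 1); split; lia.
  - by exists y, (y + 1); split; lia.
  - by exists (y - 1), y; split; lia.
  - by exists (y - 1), (y + 1); split; lia.
have col (z : int) : 0 < z < (2 * n)%N%:Z - 1 /\ (z %% 4)%Z <> 3 ->
    U ((2 * n)%N%:Z - 2, z) = (2 * n).-1.
  by case; apply: (dbl_prelast W).
apply: (good_pair (d1 := ((2 * n)%N%:Z - 2, a)) (d2 := ((2 * n)%N%:Z - 2, b))).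
- by rewrite (dbl_last W); case: eqP => //; lia.
- by apply/neighbors_pairP; lia.
- by apply/neighbors_pairP; lia.
- by apply/pair_neq; right.
- by rewrite !col.
- by rewrite col //; lia.
- move=> [x' y'] /neighbors_pairP N; rewrite col //.
  have [->|[->|->]] : x' = (2 * n)%N%:Z - 2 \/ x' = (2 * n)%N%:Z - 1 \/ x' = (2 * n)%N%:Z by lia.
  + case: (lerP y' 0) => Hy'.
      rewrite dbl_in; [|lia|lia].
      have -> : y' = 0 by lia.
      by rewrite (w_bot W); case: eqP => //; lia.
    case: (eqVneq (y' %% 4)%Z 3) => [E|/eqP ?]; last by rewrite col //; lia.
    rewrite dbl_side; [|lia|lia].
    rewrite (TE (x' := n%:Z - 1 - y') (y' := n%:Z - 1)) //; last lia.
    rewrite (w_top W); last lia.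
    case: eqP => //; lia.
  + by rewrite (dbl_last W); case: eqP => //; lia.
  + by rewrite (dbl_out W) //; lia.
Qed.

Lemma dbl_good (x y : int) : `|x| < (2 * n)%N%:Z -> 0 < y < (2 * n)%N%:Z -> good U (x, y).
Proof.
wlog x0 : x / 0 <= x => [H Hx Hy|Hx Hy].
  case: (lerP 0 x) => x0; first exact: H.
  rewrite -(good_transport (m := 0) (T := U) (T' := U) (c := (x, y)) motion_reflection) /=.
  - by apply: H => //; lia.
  - rewrite (dbl_sym W); shlia.
  - move=> [x' y'] _ /=; rewrite (dbl_sym W); shlia.
case: (ltrP n%:Z y) => Hy1.
  case: (eqVneq x 0) => [->|?]; [apply: dbl_good_axis|apply: dbl_good_up]; lia.
case: (ltrP x n%:Z) => Hx1.
  case: (eqVneq y n%:Z) => [->|?]; [apply: dbl_good_mid|apply: dbl_good_low]; lia.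
case: (eqVneq x ((2 * n)%N%:Z - 1)) => [->|?]; [apply: dbl_good_edge|apply: dbl_good_side]; lia.
Qed.

Lemma dbl_wedge : wedge (2 * n) U.
Proof.
split; first by case/andP: (w_size W) => ? ?; rewrite dvdn_mull ?andbT //; lia.
- exact: dbl_sym.
- exact: dbl_out.
- by move=> x; rewrite dbl_in ?(w_bot W) //; lia.
- exact: dbl_le.
- exact: dbl_range.
- exact: dbl_col0.
- by rewrite dbl_in ?(w_11 W) //; lia.
- exact: dbl_last.
- exact: dbl_top.
- exact: dbl_prelast.
- exact: dbl_col2.
- exact: dbl_col1.
- exact: dbl_good.
Qed.

End DoublingGood.

(** * The quadrant pattern and its doubling *)

(* Growth in x, y > 0 from the corner seed at the origin.  At stage n + 1 the
   cell (n, n) becomes a seed for a translated copy of the quadrant, flanked by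
   two wedges. *)
Definition dblq (n : nat) (T Q : cell -> nat) (c : cell) : nat :=
  let: (x, y) := c in
  if n%:Z <= x then
    if n%:Z <= y then sh n (Q (@pair int int (x - n%:Z) (y - n%:Z)))
    else sh n (T (@pair int int (n%:Z - y) (x - n%:Z)))
  else if n%:Z <= y then sh n (T (@pair int int (n%:Z - x) (y - n%:Z)))
  else Q (x, y).

Arguments dblq : simpl never.

(** By [q_axis] and [q_col1], columns 0 and 1 above row 0 are those of a wedge, so a wedge flanking
    the corner copy continues across the seam. *)
Record quadrant (n : nat) (T Q : cell -> nat) : Prop := Quadrant {
  q_sym : forall x y : int, Q (x, y) = Q (y, x);
  q_out : forall x y : int, x < 0 \/ y < 0 \/ n%:Z <= x \/ n%:Z <= y -> Q (x, y) = 0%N;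
  q_axis : forall y : int, Q (0, y) = if y == 0 then 1%N else if y == 1 then 2%N else 0%N;
  q_le : forall x y : int, (Q (x, y) <= n)%N;
  q_range : forall x y : int, Q (x, y) <> 0%N -> x < (Q (x, y))%:Z /\ y < (Q (x, y))%:Z;
  q_col1 : forall y : int, 0 < y -> Q (1, y) = T (1, y);
  q_top : forall x : int, 0 <= x < n%:Z ->
    Q (x, n%:Z - 1) = if (x %% 4)%Z == 0 then 0%N else n;
  q_good : forall x y : int, 0 < x < n%:Z -> 0 < y < n%:Z -> good Q (x, y) }.

Definition quad4 (c : cell) : nat :=
  if (0 <= c.1) && (0 <= c.2) then
    nth 0%N (nth [::] [:: [:: 1; 2; 0; 0]; [:: 2; 2; 0; 4]; [:: 0; 0; 3; 4]; [:: 0; 4; 4; 4]]%N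
      `|c.2|%N) `|c.1|%N
  else 0%N.

Lemma quad4_out (x y : int) : x < 0 \/ y < 0 \/ 4 <= x \/ 4 <= y -> quad4 (x, y) = 0%N.
Proof.
rewrite /quad4 /=; case: ifP => // H K.
case: (leqP 4 `|y|%N) => Hy; first by rewrite (nth_default [::]) ?nth_nil.
have Hx : (4 <= `|x|)%N by lia.
by move: `|y|%N Hy => [|[|[|[|]]]] //= _; rewrite nth_default.
Qed.

Lemma quad4_quadrant : quadrant 4 base4 quad4.
Proof.
have in_or_out (x y : int) : (0 <= x < 4 /\ 0 <= y < 4) \/ quad4 (x, y) = 0%N.
  case: (boolP ((0 <= x < 4) && (0 <= y < 4))) => [|H]; [lia|right].
  apply: quad4_out; lia.
split.
- move=> x y; case: (in_or_out x y) => [[Hx Hy]|E]; first by small x; small y; try lia.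
  case: (in_or_out y x) => [[Hx Hy]|->] //; by small x; small y; try lia.
- exact: quad4_out.
- move=> y; case: (boolP (0 <= y < 4)) => H; first by small y; try lia.
  rewrite quad4_out; last lia.
  case: eqP; first lia; case: eqP => //; lia.
- by move=> x y; case: (in_or_out x y) => [[Hx Hy]|-> //]; small x; small y; try lia.
- by move=> x y; case: (in_or_out x y) => [[Hx Hy]|-> //]; small x; small y; try lia.
- move=> y y0; case: (ltrP y 4) => H; first by small y; try lia.
  rewrite quad4_out ?base4_out //; lia.
- by move=> x Hx; small x; try lia.
- by move=> x y Hx Hy; small x; try lia; small y; try lia; vm_compute.
Qed.

Lemma dblq_sym (n : nat) (T Q : cell -> nat) (x y : int) :
  (forall x y : int, Q (x, y) = Q (y, x)) -> dblq n T Q (x, y) = dblq n T Q (y, x).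
Proof.
move=> H; rewrite /dblq; case: ifP => Hx; case: ifP => Hy //; by congr (sh _ _); apply: H.
Qed.

Section DoublingQuadrant.
Variables (n : nat) (T Q : cell -> nat).
Hypothesis W : wedge n T.
Hypothesis V : quadrant n T Q.
Local Notation U := (dblq n T Q).

Let n4 : (4 <= n)%N. Proof. by case/andP: (w_size W). Qed.
Let n4m : (n%:Z %% 4)%Z = 0. Proof. case/andP: (w_size W); lia. Qed.
Let TE (x y x' y' : int) : x = x' -> y = y' -> T (x, y) = T (x', y').
Proof. by move=> -> ->. Qed.
Let QE (x y x' y' : int) : x = x' -> y = y' -> Q (x, y) = Q (x', y').
Proof. by move=> -> ->. Qed.

Let U_in (x y : int) : x < n%:Z -> y < n%:Z -> U (x, y) = Q (x, y).
Proof. by move=> ? ?; rewrite /dblq; case: ifP; first lia; case: ifP => //; lia. Qed.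

Let U_corner (x y : int) : n%:Z <= x -> n%:Z <= y ->
  U (x, y) = sh n (Q (@pair int int (x - n%:Z) (y - n%:Z))).
Proof. by rewrite /dblq => -> ->. Qed.

Let U_up (x y : int) : x < n%:Z -> n%:Z <= y ->
  U (x, y) = sh n (T (@pair int int (n%:Z - x) (y - n%:Z))).
Proof. by move=> ? H; rewrite /dblq H; case: ifP => //; lia. Qed.

Let U_sym (x y : int) : U (x, y) = U (y, x).
Proof. apply: dblq_sym; exact: (q_sym V). Qed.

Let wlog_le (P : int -> int -> Prop) : (forall x y, P x y -> P y x) ->
  (forall x y : int, x <= y -> P x y) -> forall x y, P x y.
Proof. by move=> PC H x y; case: (lerP x y) => ?; [|apply: PC]; apply: H; lia. Qed.

Lemma dblq_out (x y : int) : x < 0 \/ y < 0 \/ (2 * n)%N%:Z <= x \/ (2 * n)%N%:Z <= y ->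
  U (x, y) = 0%N.
Proof.
move: x y; apply: wlog_le => [x y H K|x y xy H]; first by rewrite U_sym H //; lia.
case: (ltrP y n%:Z) => Hy; first by rewrite U_in ?(q_out V) //; lia.
case: (ltrP x n%:Z) => Hx; first by rewrite U_up ?(w_out W) //; lia.
by rewrite U_corner ?(q_out V) //; lia.
Qed.

Lemma dblq_axis (y : int) :
  U (0, y) = if y == 0 then 1%N else if y == 1 then 2%N else 0%N.
Proof.
case: (ltrP y n%:Z) => Hy; first by rewrite U_in ?(q_axis V) //; lia.
rewrite U_up; [|lia|lia].
rewrite (w_out W); last lia.
by case: eqP; first lia; case: eqP => //; lia.
Qed.

Lemma dblq_le (x y : int) : (U (x, y) <= 2 * n)%N.
Proof.
move: x y; apply: wlog_le => [x y H|x y xy]; first by rewrite U_sym.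
case: (ltrP y n%:Z) => Hy; first by rewrite U_in; [have := q_le V x y; lia|lia|lia].
case: (ltrP x n%:Z) => Hx.
  by rewrite U_up //; match goal with |- context [T (?a, ?b)] => generalize (w_le W a b) end; shlia.
by rewrite U_corner //; match goal with |- context [Q (?a, ?b)] => generalize (q_le V a b) end; shlia.
Qed.

Lemma dblq_range (x y : int) : U (x, y) <> 0%N ->
  x < (U (x, y))%:Z /\ y < (U (x, y))%:Z.
Proof.
move: x y; apply: wlog_le => [x y H K|x y xy].
  by rewrite U_sym; move: K; rewrite U_sym => /H [].
case: (ltrP y n%:Z) => Hy; first by rewrite U_in; [exact: (q_range V)|lia|lia].
case: (ltrP x n%:Z) => Hx.
  by rewrite U_up //; match goal with |- context [T (?a, ?b)] => generalize (@w_range _ _ W a b) end; shlia.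
by rewrite U_corner //; match goal with |- context [Q (?a, ?b)] => generalize (@q_range _ _ _ V a b) end; shlia.
Qed.

Lemma dblq_col1 (y : int) : 0 < y -> U (1, y) = dbl n T (1, y).
Proof.
move=> y0; case: (ltrP y n%:Z) => Hy.
  by rewrite U_in ?dbl_in ?(q_col1 V) //; lia.
rewrite U_up; [|lia|lia].
case: (eqVneq y n%:Z) => [->|ne].
  rewrite dbl_in; [|lia|lia].
  rewrite (TE (x' := n%:Z - 1) (y' := 0)) ?(w_bot W); try lia.
  rewrite (w_out W) //; last lia.
  by case: eqP => //; lia.
rewrite dbl_up; last lia.
rewrite (TE (x' := - (1 - n%:Z)) (y' := y - n%:Z)) ?(w_sym W) //; lia.
Qed.

Lemma dblq_top (x : int) : 0 <= x < (2 * n)%N%:Z ->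
  U (x, (2 * n)%N%:Z - 1) = if (x %% 4)%Z == 0 then 0%N else (2 * n)%N.
Proof.
move=> Hx; case: (ltrP x n%:Z) => Hn.
  rewrite U_up //; last lia.
  rewrite (TE (x' := n%:Z - x) (y' := n%:Z - 1)) //; last lia.
  case: (eqVneq x 0) => [->|?]; first by rewrite (w_out W) //; lia.
  rewrite (w_top W); last lia.
  by case: eqP; case: eqP => //=; try lia; shlia.
rewrite U_corner //; last lia.
rewrite (QE (x' := x - n%:Z) (y' := n%:Z - 1)) //; last lia.
rewrite (q_top V); last lia.
by case: eqP; case: eqP => //=; try lia; shlia.
Qed.

Lemma dblq_good (x y : int) : 0 < x < (2 * n)%N%:Z -> 0 < y < (2 * n)%N%:Z -> good U (x, y).
Proof.
move: x y; apply: wlog_le => [x y H Hx Hy|x y xy Hx Hy].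
  rewrite -(good_transport (m := 0) (T := U) (T' := U) (c := (y, x)) (motion_diagonal 0)) /=.
  - by rewrite addr0 subr0; apply: H.
  - by rewrite addr0 subr0 U_sym; shlia.
  - by move=> [x' y'] _ /=; rewrite addr0 subr0 U_sym; shlia.
case: (ltrP y n%:Z) => Hy1.
  have Uc : U (x, y) = sh 0 (Q (x, y)) by rewrite U_in; [shlia|lia|lia].
  have E (x' y' : int) : 0 <= x' <= n%:Z -> 0 <= y' <= n%:Z -> (x' <> n%:Z \/ y' <> n%:Z) ->
      U (x', y') = sh 0 (Q (x', y')).
    move: x' y'; apply: wlog_le => [x' y' H *|x' y' xy' Hx' Hy' ne].
      by rewrite U_sym (q_sym V); apply: H => //; lia.
    case: (ltrP y' n%:Z) => Hy2; first by rewrite U_in; [shlia|lia|lia].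
    rewrite U_up; [|lia|lia].
    rewrite (TE (x' := n%:Z - x') (y' := 0)) //; last lia.
    rewrite (w_bot W) (q_out V); last lia.
    by case: eqP; [lia|shlia].
  have G : good Q (x, y) by apply: (q_good V); lia.
  (* Across its border the old quadrant sees bottom rows of wedges, which are empty, and the new
     seed [(n, n)]. The latter touches only [(n - 1, n - 1)], whose parent is earlier. *)
  case: (boolP ((x == n%:Z - 1) && (y == n%:Z - 1))) => [/andP[/eqP Ex /eqP Ey]|ne]; last first.
    rewrite -(good_transport (T := Q) (m := 0) motion_id Uc) // => -[x' y'] /neighbors_pairP N.
    by apply: E; lia.
  have Qc : Q (x, y) = n by rewrite Ex Ey (q_top V) //; [case: eqP|]; lia.
  have Q1 : (1 < Q (x, y))%N by rewrite Qc; lia.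
  have [u Nu Eu] := good_parent Q1 G.
  apply: (good_transport_late (w := n) motion_id Uc Nu) => //; first lia.
  move=> [x' y'] /neighbors_pairP N.
  case: (boolP ((x' == n%:Z) && (y' == n%:Z))) => [/andP[/eqP -> /eqP ->]|ne].
    right; split; first by left; apply: (q_out V); lia.
    right; rewrite U_corner // (QE (x' := 0) (y' := 0)) ?subrr // (q_axis V) /=; shlia.
  by left; apply: E; lia.
have late (x' y' : int) : n%:Z <= y' -> U (x', y') <> 0%N -> (n < U (x', y'))%N.
  move=> ?; case: (ltrP x' n%:Z) => ?; first by rewrite U_up //; shlia.
  by rewrite U_corner //; shlia.
have top (z : int) : 0 <= z < n%:Z /\ (z %% 4)%Z <> 0 -> U (z, n%:Z - 1) = n.
  move=> [Hz /eqP/negbTE Hz4]; rewrite U_in; [|lia|lia].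
  by rewrite (q_top V) // Hz4.
have edge : U (n%:Z, n%:Z - 1) = 0%N.
  rewrite U_sym U_up //; last lia.
  rewrite (TE (x' := 1) (y' := 0)) ?(w_bot W) //; lia.
have low (x' : int) : 0 <= x' <= n%:Z -> U (x', n%:Z - 1) <> 0%N -> U (x', n%:Z - 1) = n.
  move=> Hx'; case: (eqVneq x' n%:Z) => [->|?]; first by rewrite edge.
  rewrite U_in ?(q_top V); [|lia|lia|lia].
  by case: eqP.
case: (eqVneq y n%:Z) => [Ey|ny].
  (* The new seed has the end of the old top row as its only neighbor of stage [n]; all its other ON
     neighbors lie beyond the seams and are late. *)
  case: (eqVneq x n%:Z) => [Ex|nx].
    have Uc : U (x, y) = n.+1.
      rewrite Ex Ey U_corner // (QE (x' := 0) (y' := 0)) ?subrr // (q_axis V) /=; shlia.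
    have Tn : U (n%:Z - 1, n%:Z - 1) = n by apply: top; lia.
    apply/good_on; first by rewrite Uc.
    exists (n%:Z - 1, n%:Z - 1); rewrite Tn Uc; split=> //; first by apply/neighbors_pairP; lia.
      lia.
    move=> [x' y'] /neighbors_pairP N /pair_neq ne Ue.
    case: (ltrP y' n%:Z) => Hy'; last by apply: late.
    have Ey' : y' = n%:Z - 1 by lia.
    case: (ltrP x' n%:Z) => Hx'; first lia.
    by move: Ue; rewrite U_sym => Ue; apply: late.
  have [a [b [Na Nb ne Ta Tb]]] : exists a b : int, [/\ `|a - x| <= 1, `|b - x| <= 1, a <> b,
      0 <= a < n%:Z /\ (a %% 4)%Z <> 0 & 0 <= b < n%:Z /\ (b %% 4)%Z <> 0].
    have : (x %% 4)%Z = 0 \/ (x %% 4)%Z = 1 \/ (x %% 4)%Z = 2 \/ (x %% 4)%Z = 3 by lia.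
    case=> [H|[H|[H|H]]].
    - by exists (x - 1), (x + 1); split; lia.
    - by exists x, (x + 1); split; lia.
    - by exists (x - 1), x; split; lia.
    - by exists (x - 1), x; split; lia.
  apply: (good_pair (d1 := (a, n%:Z - 1)) (d2 := (b, n%:Z - 1))).
  - rewrite Ey U_up //; last lia.
    rewrite (TE (x' := n%:Z - x) (y' := 0)) ?subrr // (w_bot W).
    by case: eqP; [lia|shlia].
  - by apply/neighbors_pairP; lia.
  - by apply/neighbors_pairP; lia.
  - by apply/pair_neq; left.
  - by rewrite !top.
  - by rewrite top //; lia.
  - move=> [x' y'] /neighbors_pairP N; rewrite top // => Ue.
    case: (ltrP y' n%:Z) => Hy'; last by apply/ltnW/late.
    have Ey' : y' = n%:Z - 1 by lia.
    by move: Ue; rewrite Ey' => Ue; rewrite low //; lia.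
case: (lerP x n%:Z) => Hx1; last first.
  have E (x' y' : int) : n%:Z <= x' -> n%:Z <= y' ->
      U (x', y') = sh n (Q (x' + - n%:Z, y' + - n%:Z)).
    by move=> ? ?; rewrite U_corner.
  rewrite -(good_transport (T := Q) (m := n) (T' := U) (c := (x, y))
             (motion_translation (- n%:Z) (- n%:Z))) /=.
  - by apply: (q_good V); lia.
  - by apply: E; lia.
  - by move=> [x' y'] /neighbors_pairP N; apply: E; lia.
pose f (c : cell) : cell := (n%:Z - c.1, c.2 - n%:Z).
pose g (c : cell) : cell := (n%:Z - c.1, c.2 + n%:Z).
have M : motion f g.
  by apply: motionI => [x' y'|x' y'|x1 y1 x2 y2] /=; rewrite /f /g /=; [congr pair; lia|congr pair; lia|lia].
(* The wedge copy is followed one column into the corner quadrant. The excepted cell [(n + 1, n)] is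
   an axis cell of that quadrant, of stage [n + 2], hence later than the seed; it matters only at
   [(n, n + 1)]. *)
have E (x' y' : int) : x' <= n%:Z \/ n%:Z < y' -> x' <= n%:Z + 1 -> n%:Z <= y' ->
    U (x', y') = sh n (T (f (x', y'))).
  move=> H1 H2 H3; case: (ltrP x' n%:Z) => Hx'; first by rewrite U_up.
  rewrite U_corner //; congr (sh _ _); rewrite /f /=.
  case: (eqVneq x' n%:Z) => [->|?].
    rewrite (QE (x' := 0) (y' := y' - n%:Z)) ?subrr // (q_axis V).
    case: eqP => [->|?]; first by rewrite (w_bot W).
    by rewrite (w_col0 W) //; lia.
  rewrite (QE (x' := 1) (y' := y' - n%:Z)) //; last lia.
  rewrite (q_col1 V); last lia.
  by rewrite (TE (x := n%:Z - x') (x' := - 1) (y' := y' - n%:Z)) ?(w_sym W) //; lia.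
have Uc : U (x, y) = sh n (T (f (x, y))) by apply: E; lia.
have G : good T (f (x, y)) by apply: (w_good W) => /=; lia.
case: (boolP ((x == n%:Z) && (y == n%:Z + 1))) => [/andP[/eqP Ex /eqP Ey]|ne]; last first.
  rewrite -(good_transport M Uc) // => -[x' y'] /neighbors_pairP N.
  by apply: E; lia.
apply: (good_transport_late (w := 2) (u := (0, 0)) M Uc) => //.
- by apply/neighbors_pairP => /=; lia.
- by rewrite (w_bot W).
- move=> [x' y'] /neighbors_pairP N.
  case: (boolP ((x' == n%:Z + 1) && (y' == n%:Z))) => [/andP[/eqP -> /eqP ->]|ne].
    right; split.
      left; rewrite /f /= (TE (x' := - 1) (y' := 0)) ?(w_bot W) //; lia.
    right; rewrite U_corner; [|lia|lia].
    rewrite (QE (x' := 1) (y' := 0)); [|lia|lia].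
    rewrite (q_sym V) (q_axis V) /=; shlia.
  by left; apply: E; lia.
Qed.

Lemma dblq_quadrant : quadrant (2 * n) (dbl n T) U.
Proof.
split.
- exact: U_sym.
- exact: dblq_out.
- exact: dblq_axis.
- exact: dblq_le.
- exact: dblq_range.
- exact: dblq_col1.
- exact: dblq_top.
- exact: dblq_good.
Qed.

End DoublingQuadrant.

(** * The three automata *)

Fixpoint wedge_at (k : nat) : cell -> nat :=
  if k is k'.+1 then dbl (2 ^ k'.+2) (wedge_at k') else base4.

Fixpoint quadrant_at (k : nat) : cell -> nat :=
  if k is k'.+1 then dblq (2 ^ k'.+2) (wedge_at k') (quadrant_at k') else quad4.

Lemma wedge_atP k : wedge (2 ^ k.+2) (wedge_at k).
Proof.
elim: k => [|k IH]; first exact: base4_wedge.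
by rewrite expnS; apply: dbl_wedge.
Qed.

Lemma quadrant_atP k : quadrant (2 ^ k.+2) (wedge_at k) (quadrant_at k).
Proof.
elim: k => [|k IH]; first exact: quad4_quadrant.
by rewrite expnS; apply: dblq_quadrant => //; apply: wedge_atP.
Qed.

Lemma wedge_at_stable k k' (x y : int) : (k <= k')%N ->
  `|x| < (2 ^ k.+2)%N%:Z -> y < (2 ^ k.+2)%N%:Z -> wedge_at k' (x, y) = wedge_at k (x, y).
Proof.
move=> /subnK <-; elim: (k' - k)%N => [|m IH] // Hx Hy.
have H : (2 ^ k.+2 <= 2 ^ (m + k).+2)%N by rewrite leq_exp2l //; lia.
by rewrite -IH // addSn /= dbl_in //; lia.
Qed.

Lemma quadrant_at_stable k k' (x y : int) : (k <= k')%N ->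
  x < (2 ^ k.+2)%N%:Z -> y < (2 ^ k.+2)%N%:Z -> quadrant_at k' (x, y) = quadrant_at k (x, y).
Proof.
move=> /subnK <-; elim: (k' - k)%N => [|m IH] // Hx Hy.
have H : (2 ^ k.+2 <= 2 ^ (m + k).+2)%N by rewrite leq_exp2l //; lia.
by rewrite -IH // addSn /= /dblq; case: ifP; [lia|case: ifP => //; lia].
Qed.

(** The limit pattern: doubling leaves the old cells unchanged, and the level [|x| + |y|] is already
    large enough to contain the cell. *)
Definition wedge_time (c : cell) : nat := wedge_at (absz c.1 + absz c.2) c.
Definition quadrant_time (c : cell) : nat := quadrant_at (absz c.1 + absz c.2) c.

Lemma ltn_level (a k : nat) : (a <= k)%N -> (a < 2 ^ k.+2)%N.
Proof. by move=> ak; apply: (leq_ltn_trans ak); apply: ltn_trans (ltn_expl _ _); lia. Qed.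

Lemma wedge_timeE k (x y : int) : `|x| < (2 ^ k.+2)%N%:Z -> y < (2 ^ k.+2)%N%:Z ->
  wedge_time (x, y) = wedge_at k (x, y).
Proof.
move=> Hx Hy; rewrite /wedge_time /=; set m := (_ + _)%N.
have Hm := @ltn_level (absz x) m ltac:(lia).
have Hm' := @ltn_level (absz y) m ltac:(lia).
case: (leqP k m) => km; first by rewrite (wedge_at_stable km).
by rewrite (wedge_at_stable (ltnW km)) //; lia.
Qed.

Lemma quadrant_timeE k (x y : int) : x < (2 ^ k.+2)%N%:Z -> y < (2 ^ k.+2)%N%:Z ->
  quadrant_time (x, y) = quadrant_at k (x, y).
Proof.
move=> Hx Hy; rewrite /quadrant_time /=; set m := (_ + _)%N.
have Hm := @ltn_level (absz x) m ltac:(lia).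
have Hm' := @ltn_level (absz y) m ltac:(lia).
case: (leqP k m) => km; first by rewrite (quadrant_at_stable km).
by rewrite (quadrant_at_stable (ltnW km)) //; lia.
Qed.

Lemma wedge_time_sym (x y : int) : wedge_time (- x, y) = wedge_time (x, y).
Proof. by rewrite /wedge_time /= abszN (w_sym (wedge_atP _)). Qed.

Lemma wedge_time_bot (x : int) : wedge_time (x, 0) = (x == 0).
Proof. exact: (w_bot (wedge_atP _)). Qed.

Lemma wedge_time_col0 (y : int) : 0 < y ->
  wedge_time (0, y) = if y == 1 then 2%N else 0%N.
Proof. exact: (w_col0 (wedge_atP _)). Qed.

Lemma wedge_time_range (x y : int) : wedge_time (x, y) <> 0%N ->
  `|x| < (wedge_time (x, y))%:Z /\ y < (wedge_time (x, y))%:Z.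
Proof. exact: (w_range (wedge_atP _)). Qed.

Lemma quadrant_time_sym (x y : int) : quadrant_time (x, y) = quadrant_time (y, x).
Proof. by rewrite /quadrant_time /= addnC (q_sym (quadrant_atP _)). Qed.

Lemma quadrant_time_axis (y : int) :
  quadrant_time (0, y) = if y == 0 then 1%N else if y == 1 then 2%N else 0%N.
Proof. exact: (q_axis (quadrant_atP _)). Qed.

Lemma quadrant_time_range (x y : int) : quadrant_time (x, y) <> 0%N ->
  x < (quadrant_time (x, y))%:Z /\ y < (quadrant_time (x, y))%:Z.
Proof. exact: (q_range (quadrant_atP _)). Qed.

(** The cell [(1, 1)], ON at stage 2, seeds the wedge above. From row 1 downwards the rotated wedge
    of the seed remains: one half and, in row 1, its column 1. *)
Definition time1 (c : cell) : nat :=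
  let: (x, y) := c in
  if 1 < y then sh 1 (wedge_time (@pair int int (x - 1) (y - 1)))
  else if 0 <= x then wedge_time (y, x) else 0%N.

(* The regions x < 0 < y and y <= 0 <= x hold half wedges, exchanged by the
   symmetry of the corner. *)
Definition time2 (c : cell) : nat :=
  let: (x, y) := c in
  if 0 < y then
    if 0 <= x then quadrant_time (@pair int int x (y - 1))
    else wedge_time (@pair int int x (y - 1))
  else if 0 <= x then wedge_time (@pair int int (1 - y) x) else 0%N.

Definition time (c : cell) : nat := quadrant_time (`|c.1|%N%:Z, `|c.2|%N%:Z).

Arguments time1 : simpl never.
Arguments time2 : simpl never.
Arguments time : simpl never.

Lemma off_cornerE (x y : int) : off_corner (x, y) = (0 < x) || (1 < y).
Proof. rewrite /off_corner /third_quadrant /=; lia. Qed.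

(** Around [(n - 1, n - 1)] a doubled wedge shows this history delayed by [n - 1], and [n] may be
    taken as large as the window demands. *)
Lemma time1_good (x y : int) : 0 < x \/ 1 < y -> good time1 (x, y).
Proof.
move=> H.
pose k := (absz x + absz y + 5)%N; pose n := (2 ^ k.+2)%N.
have nk : (k < n)%N by apply: ltn_level.
have W : wedge n (wedge_at k) by apply: wedge_atP.
have WE (x' y' : int) : `|x'| < n%:Z -> y' < n%:Z -> wedge_time (x', y') = wedge_at k (x', y').
  exact: wedge_timeE.
pose U := dbl n (wedge_at k).
have E (x' y' : int) : `|x' - x| <= 1 -> `|y' - y| <= 1 ->
    U (x' + (n%:Z - 1), y' + (n%:Z - 1)) = sh n.-1 (time1 (x', y')).
  move=> Hx' Hy'; rewrite /time1; case: (ltrP 1 y') => H1.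
    rewrite /U dbl_up; last lia.
    rewrite WE; [|lia|lia].
    have -> : (absz (x' + (n%:Z - 1)))%:Z - n%:Z = x' - 1 by lia.
    have -> : y' + (n%:Z - 1) - n%:Z = y' - 1 by lia.
    shlia.
  case: (lerP 0 x') => H0; last first.
    rewrite /U dbl_in; [|lia|lia].
    by rewrite (w_out W) //; lia.
  case: (eqVneq x' 0) => [->|ne].
    rewrite /U dbl_in; [|lia|lia].
    rewrite add0r (w_last W) wedge_time_bot.
    have -> : (y' + (n%:Z - 1) == n%:Z - 1) = (y' == 0) by apply/eqP/eqP; lia.
    by case: eqP => // _; shlia.
  rewrite /U dbl_side; [|lia|lia].
  have -> : n%:Z - 1 - (y' + (n%:Z - 1)) = - y' by lia.
  have -> : (absz (x' + (n%:Z - 1)))%:Z + 1 - n%:Z = x' by lia.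
  rewrite (w_sym W) WE //; lia.
have : good U (x + (n%:Z - 1), y + (n%:Z - 1)) by apply: (dbl_good W); lia.
rewrite -(good_transport (T := time1) (m := n.-1)
  (motion_translation (- (n%:Z - 1)) (- (n%:Z - 1)))) /=.
- by rewrite !addrK.
- by rewrite !addrK E // subrr.
- move=> [x' y'] /neighbors_pairP N /=.
  rewrite -E; [|lia|lia].
  by rewrite !subrK.
Qed.

(** The same with a doubled quadrant and delay [n]; its inner seed [(n, n)] corresponds to the seed
    [(0, 1)]. *)
Lemma time2_good (x y : int) : 0 < x \/ 1 < y -> good time2 (x, y).
Proof.
move=> H.
pose k := (absz x + absz y + 5)%N; pose n := (2 ^ k.+2)%N.
have nk : (k < n)%N by apply: ltn_level.
have W : wedge n (wedge_at k) by apply: wedge_atP.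
have V : quadrant n (wedge_at k) (quadrant_at k) by apply: quadrant_atP.
have WE (x' y' : int) : `|x'| < n%:Z -> y' < n%:Z -> wedge_time (x', y') = wedge_at k (x', y').
  exact: wedge_timeE.
have VE (x' y' : int) : x' < n%:Z -> y' < n%:Z ->
    quadrant_time (x', y') = quadrant_at k (x', y').
  exact: quadrant_timeE.
pose U := dblq n (wedge_at k) (quadrant_at k).
have E (x' y' : int) : `|x' - x| <= 1 -> `|y' - y| <= 1 ->
    U (x' + n%:Z, y' + (n%:Z - 1)) = sh n (time2 (x', y')).
  move=> Hx' Hy'; rewrite /time2 /U /dblq.
  case: ifP => C1; case: ifP => C2; case: ifP => D1; case: ifP => D2; try lia.
  - rewrite VE; [|lia|lia].
    have -> : x' + n%:Z - n%:Z = x' by lia.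
    by have -> : y' + (n%:Z - 1) - n%:Z = y' - 1 by lia.
  - rewrite WE; [|lia|lia].
    have -> : x' + n%:Z - n%:Z = x' by lia.
    by have -> : n%:Z - (y' + (n%:Z - 1)) = 1 - y' by lia.
  - rewrite WE; [|lia|lia].
    have -> : n%:Z - (x' + n%:Z) = - x' by lia.
    have -> : y' + (n%:Z - 1) - n%:Z = y' - 1 by lia.
    by rewrite (w_sym W).
have : good U (x + n%:Z, y + (n%:Z - 1)) by apply: (dblq_good W V); lia.
rewrite -(good_transport (T := time2) (m := n)
  (motion_translation (- n%:Z) (- (n%:Z - 1)))) /=.
- by rewrite !addrK.
- by rewrite !addrK E // subrr.
- move=> [x' y'] /neighbors_pairP N /=.
  rewrite -E; [|lia|lia].
  by rewrite !subrK.
Qed.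

Lemma good_sym (T : cell -> nat) (f : cell -> cell) c :
  motion f f -> (forall d, T (f d) = T d) -> good T (f c) = good T c.
Proof. by move=> M H; apply: (good_transport (m := 0) M) => [|d _]; rewrite H; shlia. Qed.

Lemma time_good (x y : int) : x <> 0 \/ y <> 0 -> good time (x, y).
Proof.
have tN (a b : int) : time (- a, b) = time (a, b) by rewrite /time /= abszN.
have tS (a b : int) : time (a, b) = time (b, a) by rewrite /time /= quadrant_time_sym.
have gN (a b : int) : good time (- a, b) = good time (a, b).
  by apply: (good_sym (a, b) motion_reflection) => -[x' y']; rewrite tN.
have gS (a b : int) : good time (a, b) = good time (b, a).
  have := @good_sym time _ (b, a) (motion_diagonal 0) => /= <-; first by rewrite subr0 addr0.
  by move=> [x' y'] /=; rewrite subr0 addr0 tS.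
have tE (x' y' : int) : 0 <= x' -> 0 <= y' -> time (x', y') = quadrant_time (x', y').
  by move=> ? ?; rewrite /time /=; congr (quadrant_time (_, _)); lia.
have inner (a b : int) : 0 < a -> 0 < b -> good time (a, b).
  move=> a0 b0; pose k := (absz a + absz b + 5)%N; pose n := (2 ^ k.+2)%N.
  have nk : (k < n)%N by apply: ltn_level.
  have E (x' y' : int) : `|x' - a| <= 1 -> `|y' - b| <= 1 ->
      time (x', y') = sh 0 (quadrant_at k (x', y')).
    move=> ? ?; rewrite tE ?(@quadrant_timeE k); try lia; shlia.
  have : good (quadrant_at k) (a, b) by apply: (q_good (quadrant_atP k)); lia.
  rewrite (good_transport (m := 0) (T' := time) motion_id) //; first by apply: E; lia.
  by move=> [x' y'] /neighbors_pairP N'; apply: E; lia.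
have col (y' : int) : time (0, y') =
    if y' == 0 then 1%N else if `|y'| == 1 then 2%N else 0%N.
  rewrite /time /= quadrant_time_axis.
  have -> : ((absz y')%:Z == 0) = (y' == 0) by apply/eqP/eqP; lia.
  by have -> : ((absz y')%:Z == 1) = (`|y'| == 1) by apply/eqP/eqP; lia.
have pos (x' y' : int) : y' <> 0 -> time (x', y') <> 0%N -> (2 <= time (x', y'))%N.
  by move=> ? H; have := quadrant_time_range H; rewrite /time /=; lia.
have axis (b : int) : 0 < b -> good time (0, b).
  move=> b0; case: (eqVneq b 1) => [->|b1].
    apply/good_on; first by rewrite col.
    exists (0, 0); rewrite !col; split=> //.
    move=> [x' y'] /neighbors_pairP N /pair_neq ne.
    case: (eqVneq y' 0) => [E|?]; last by apply: pos; lia.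
    by rewrite E tS; apply: pos; lia.
  have cb : time (0, b) = 0%N by rewrite col; case: eqP; [lia|case: eqP => //; lia].
  (* Height 2 is treated apart from the reflection argument because its neighbor [(0, 1)] is ON and
     fixed by the reflection. *)
  case: (eqVneq b 2) => [E|b2].
    have t1 : time (1, 1) = 2%N by [].
    apply: (good_pair (d1 := (1, 1)) (d2 := (- 1, 1))) => //.
    - by apply/neighbors_pairP; lia.
    - by apply/neighbors_pairP; lia.
    - move=> [x' y'] /neighbors_pairP N; rewrite t1; apply: pos; lia.
  apply: (good_involution (s := fun c => (- c.1, c.2))) => //.
  move=> [x' y'] /neighbors_pairP N Tx; split; last exact: tN.
    by apply/neighbors_pairP => /=; lia.
  apply/pair_neq; left => /=.
  case: (eqVneq x' 0) => [E|]; last lia.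
  by move: Tx; rewrite E col; case: eqP; [lia|case: eqP; [lia|]].
have upper (a b : int) : 0 <= a -> 0 <= b -> a <> 0 \/ b <> 0 -> good time (a, b).
  move=> a0 b0 N; case: (eqVneq a 0) => [E|?]; first by rewrite E; apply: axis; lia.
  case: (eqVneq b 0) => [E|?]; first by rewrite E gS; apply: axis; lia.
  by apply: inner; lia.
have right (a b : int) : 0 <= b -> a <> 0 \/ b <> 0 -> good time (a, b).
  by move=> b0 N; case: (lerP 0 a) => a0; [|rewrite -gN]; apply: upper; lia.
by move=> N; case: (lerP 0 y) => y0; [|rewrite gS -gN gS]; apply: right; lia.
Qed.

(** * From the local rule to the automaton *)

Lemma neighbors_uniq (c : cell) : uniq (neighbors c).
Proof. by case: c => i j; rewrite /= !inE !xpair_eqE; lia. Qed.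

Lemma count_eq1 (T : eqType) (P : pred T) (s : seq T) (d : T) : uniq s ->
  d \in s -> P d -> (forall e, e \in s -> P e -> e = d) -> count P s = 1%N.
Proof.
move=> Us Ds Pd H; have -> : count P s = count_mem d s.
  apply: eq_in_count => e Es /=; apply/idP/eqP => [|->] //; exact: H.
by rewrite count_uniq_mem // Ds.
Qed.

Lemma count_gt1 (T : eqType) (P : pred T) (s : seq T) (d e : T) :
  d \in s -> e \in s -> d <> e -> P d -> P e -> (1 < count P s)%N.
Proof.
move=> Ds Es de Pd Pe; rewrite -size_filter.
have : (size [:: d; e] <= size (filter P s))%N.
  apply: uniq_leq_size => [|z]; first by rewrite /= inE; case: eqP.
  by rewrite !inE mem_filter => /orP[] /eqP ->; rewrite ?Pd ?Pe.
by [].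
Qed.

Section TimeFunction.
Variables (allowed : pred cell) (seed : cell) (T : cell -> nat).
Hypothesis T_seed : T seed = 1%N.
Hypothesis T_good : forall c, c <> seed -> allowed c -> good T c.
Hypothesis T_disallowed : forall c, c <> seed -> ~~ allowed c -> T c = 0%N.

Lemma mem_on_cells (n : nat) (c : cell) : (c \in on_cells allowed seed n) = (0 < T c <= n)%N.
Proof.
case: n => [|n]; first by rewrite inE; lia.
rewrite /=; elim: n c => [|n IH] c /=.
  rewrite inE; case: eqP => [->|ne]; first by rewrite T_seed.
  case: (boolP (allowed c)) => Ac; last by rewrite T_disallowed.
  case: (eqVneq (T c) 0%N) => [->//|Tc].
  have /(good_on Tc)[d [_ Td E _]] := T_good ne Ac; lia.
rewrite in_extend IH (eq_count (a2 := fun d => (0 < T d <= n.+1)%N)) //.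
case: (eqVneq c seed) => [->|/eqP ne]; first by rewrite T_seed.
case: (boolP (allowed c)) => Ac /=; last by rewrite T_disallowed.
have G := T_good ne Ac.
case: (eqVneq (T c) 0%N) => [T0|T1].
  (* A single ON neighbor is impossible: [good_off] provides a second one that is at least as
     early. *)
  rewrite T0 /=; apply/eqP => C1.
  have /hasP[d Nd Pd] : has (fun d => (0 < T d <= n.+1)%N) (neighbors c) by rewrite has_count C1.
  have [e [Ne ed Te]] := (good_off T0).1 G d Nd ltac:(lia).
  have Pe : (0 < T e <= n.+1)%N by lia.
  have := @count_gt1 _ (fun d => (0 < T d <= n.+1)%N) _ _ _ Nd Ne (nesym ed) Pd Pe.
  by rewrite C1.
have [d [Nd Td E H]] := (good_on T1).1 G.
have H' e : e \in neighbors c -> (0 < T e < T c)%N -> e = d.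
  by move=> Ne Te; apply/eqP; apply: contraT => /eqP ed; have := H e Ne ed ltac:(lia); lia.
case: (ltngtP (T d) n.+1) => C.
- have -> : (0 < T c <= n.+1)%N by lia.
  lia.
- have -> : count (fun d => (0 < T d <= n.+1)%N) (neighbors c) = 0%N.
    apply/eqP; rewrite -leqn0 leqNgt -has_count; apply/hasPn => e Ne.
    apply/negP => Te; have Ee := H' e Ne ltac:(lia); move: Te; rewrite Ee; lia.
  lia.
- rewrite (@count_eq1 _ _ _ d) ?neighbors_uniq //; [lia|lia|].
  by move=> e Ne Te; apply: H' => //; lia.
Qed.

Lemma mem_turned_on (n : nat) (c : cell) : (0 < n)%N ->
  (c \in on_cells allowed seed n `\` on_cells allowed seed n.-1)%fset = (T c == n).
Proof. move=> n0; rewrite in_fsetD !mem_on_cells; lia. Qed.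

End TimeFunction.

(** * Counting *)

Lemma count_allpairs_sum (A B C : Type) (P : pred C) (f : A -> B -> C) s t :
  count P [seq f x y | x <- s, y <- t] = (\sum_(x <- s) \sum_(y <- t) P (f x y))%N.
Proof.
elim: s => [|x s IH]; first by rewrite big_nil.
rewrite big_cons /= count_cat IH count_map -sum1_count big_mkcond /=; congr addn.
Qed.

(* Sums over [a - M, a + M), folded around the gap between a - 1 and a. *)
Lemma sum_folded (M : nat) (a : int) (F : int -> nat) :
  (\sum_(0 <= i < 2 * M) F ((a - M%:Z + i%:Z)%R) =
   \sum_(0 <= i < M) (F ((a + i%:Z)%R) + F ((a - 1 - i%:Z)%R)))%N.
Proof.
rewrite (@big_cat_nat _ _ _ M) //=; last lia.
rewrite addnC big_split /=; congr addn.
  rewrite -{1}[M]add0n big_addn; have -> : (2 * M - M)%N = M by lia.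
  by apply: eq_bigr => i _; congr F; lia.
rewrite big_nat_rev /= big_nat_cond [RHS]big_nat_cond.
by apply: eq_bigr => i Hi; congr F; lia.
Qed.

(** Cutting the plane into quarters at a suitable corner lets the symmetries of a history identify
    the four sums. *)
Lemma card_folded (X : {fset cell}) (P : cell -> bool) (M : nat) (a b : int) :
  (forall c, (c \in X) = P c) ->
  (forall x y, P (x, y) -> `|x - a| < M%:Z /\ `|y - b| < M%:Z) ->
  #|` X| = (\sum_(0 <= i < M) \sum_(0 <= j < M)
     (P ((a + i%:Z)%R, (b + j%:Z)%R) + P ((a - 1 - i%:Z)%R, (b + j%:Z)%R)
      + P ((a + i%:Z)%R, (b - 1 - j%:Z)%R) + P ((a - 1 - i%:Z)%R, (b - 1 - j%:Z)%R)))%N.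
Proof.
move=> XP PM.
pose L : seq cell := [seq (a - M%:Z + i%:Z, b - M%:Z + j%:Z) | i <- iota 0 (2 * M), j <- iota 0 (2 * M)].
have UL : uniq L.
  apply: allpairs_uniq; rewrite ?iota_uniq // => -[i j] [i' j'] _ _ /= [] E1 E2.
  have -> : i = i' by lia.
  by have -> : j = j' by lia.
have -> : #|` X| = count P L.
  rewrite -size_filter; apply: perm_size; apply: uniq_perm.
  - exact: fset_uniq.
  - exact: filter_uniq.
  move=> c; rewrite mem_filter; have -> : (c \in enum_fset X) = (c \in X) by [].
  rewrite XP; case: (boolP (P c)) => //= Pc; apply/esym/allpairsP.
  case: c Pc => x y /PM[Hx Hy].
  exists (absz (x - a + M%:Z)%R, absz (y - b + M%:Z)%R); split=> /=; rewrite ?mem_iota; try lia.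
  by congr pair; lia.
rewrite count_allpairs_sum.
have -> : iota 0 (2 * M) = index_iota 0 (2 * M) by rewrite /index_iota subn0.
rewrite (sum_folded M a (fun x => \sum_(0 <= j < 2 * M) P (x, (b - M%:Z + j%:Z)%R))%N).
apply: eq_bigr => i _; 
rewrite (sum_folded M b (fun y => nat_of_bool (P ((a + i%:Z)%R, y)))).
rewrite (sum_folded M b (fun y => nat_of_bool (P ((a - 1 - i%:Z)%R, y)))).
rewrite -big_split /=; apply: eq_bigr => j _; lia.
Qed.

Lemma sum_stable (F : nat -> nat) (t M : nat) : (t <= M)%N ->
  (forall i, (t <= i)%N -> F i = 0%N) ->
  (\sum_(0 <= i < M) F i = \sum_(0 <= i < t) F i)%N.
Proof.
move=> tM H; rewrite (@big_cat_nat _ _ _ t) //=.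
have -> : (\sum_(t <= i < M) F i = 0)%N; last by rewrite addn0.
by rewrite big_nat_cond big1 // => i /andP[/andP[/H]].
Qed.

Lemma sum_stable2 (F : nat -> nat -> nat) (t M N : nat) : (t <= M)%N -> (t <= N)%N ->
  (forall i j, (t <= i)%N || (t <= j)%N -> F i j = 0%N) ->
  (\sum_(0 <= i < M) \sum_(0 <= j < N) F i j =
   \sum_(0 <= i < t) \sum_(0 <= j < t) F i j)%N.
Proof.
move=> tM tN H; rewrite (sum_stable tM); last first.
  by move=> i ti; rewrite big1 // => j _; rewrite H ?ti.
by apply: eq_bigr => i _; apply: sum_stable => // j tj; rewrite H ?tj ?orbT.
Qed.

Lemma sum_double (F : nat -> nat) (n : nat) :
  (\sum_(0 <= i < 2 * n) F i = \sum_(0 <= i < n) F i + \sum_(0 <= i < n) F (n + i))%N.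
Proof.
rewrite (@big_cat_nat _ _ _ n) //=; last lia.
congr addn; rewrite -{1}[n]add0n big_addn; have -> : (2 * n - n)%N = n by lia.
by apply: eq_bigr => i _; rewrite addnC.
Qed.

Lemma sum_shift (F : nat -> nat) (M : nat) :
  (\sum_(0 <= i < M) F i.+1 + F 0 = \sum_(0 <= i < M) F i + F M)%N.
Proof. by rewrite addnC -big_nat_recl // big_nat_recr. Qed.

Lemma sum_rev (F : nat -> nat) (n : nat) :
  (\sum_(0 <= i < n) F i = \sum_(0 <= i < n) F (n - 1 - i))%N.
Proof.
rewrite big_nat_rev /= big_nat_cond [RHS]big_nat_cond.
by apply: eq_bigr => i Hi; congr F; lia.
Qed.

Lemma sum_eq (F G : nat -> nat) (M : nat) : (forall i, (i < M)%N -> F i = G i) ->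
  (\sum_(0 <= i < M) F i = \sum_(0 <= i < M) G i)%N.
Proof. by move=> H; apply: eq_big_nat => i /andP[_]; apply: H. Qed.

Lemma sum_eq2 (F G : nat -> nat -> nat) (M N : nat) :
  (forall i j, (i < M)%N -> (j < N)%N -> F i j = G i j) ->
  (\sum_(0 <= i < M) \sum_(0 <= j < N) F i j =
   \sum_(0 <= i < M) \sum_(0 <= j < N) G i j)%N.
Proof. by move=> H; apply: sum_eq => i Hi; apply: sum_eq => j Hj; apply: H. Qed.

Lemma sum_pred1 (a M : nat) : (a < M)%N -> (\sum_(0 <= i < M) (i == a) = 1)%N.
Proof.
move=> aM; rewrite (bigD1_seq a) ?mem_index_iota ?iota_uniq //= eqxx big1 ?addn0 //.
by move=> i /negbTE ->.
Qed.

(** A half wedge with its axis but without its bottom row; the two halves of a wedge then share only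
    the axis cell of stage 2. *)
Definition wedge_count (t : nat) : nat :=
  (\sum_(0 <= i < t) \sum_(0 <= j < t) (wedge_time (i%:Z, j.+1%:Z)%R == t))%N.

(** A rotated copy keeps a half wedge and, beyond its axis, this one column. *)
Definition ray_count (t : nat) : nat :=
  (\sum_(0 <= j < t) (wedge_time (1%R, j.+1%:Z) == t))%N.

(* The axes are included here, unlike in [wedge_count]. *)
Definition quadrant_count (t : nat) : nat :=
  (\sum_(0 <= i < t) \sum_(0 <= j < t) (quadrant_time (i%:Z, j%:Z) == t))%N.

Lemma wedge_time_late (t : nat) (x y : int) : (0 < t)%N -> t%:Z <= `|x| \/ t%:Z <= y ->
  (wedge_time (x, y) == t) = false.
Proof.
move=> t0 H; apply/eqP => E.
have : wedge_time (x, y) <> 0%N by rewrite E; lia.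
by move=> /wedge_time_range; rewrite E; lia.
Qed.

Lemma quadrant_time_late (t : nat) (x y : int) : (0 < t)%N -> t%:Z <= x \/ t%:Z <= y ->
  (quadrant_time (x, y) == t) = false.
Proof.
move=> t0 H; apply/eqP => E.
have : quadrant_time (x, y) <> 0%N by rewrite E; lia.
by move=> /quadrant_time_range; rewrite E; lia.
Qed.

Lemma wedge_countE (t M N : nat) : (0 < t)%N -> (t <= M)%N -> (t <= N)%N ->
  (\sum_(0 <= i < M) \sum_(0 <= j < N) (wedge_time (i%:Z, j.+1%:Z)%R == t))%N = wedge_count t.
Proof.
move=> t0 tM tN; apply: sum_stable2 => // i j H.
by rewrite wedge_time_late //; move: H; lia.
Qed.

Lemma ray_countE (t M : nat) : (0 < t)%N -> (t <= M)%N ->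
  (\sum_(0 <= j < M) (wedge_time (1%R, j.+1%:Z) == t))%N = ray_count t.
Proof.
move=> t0 tM; apply: sum_stable => // j H.
by rewrite wedge_time_late //; move: H; lia.
Qed.

Lemma quadrant_countE (t M N : nat) : (0 < t)%N -> (t <= M)%N -> (t <= N)%N ->
  (\sum_(0 <= i < M) \sum_(0 <= j < N) (quadrant_time (i%:Z, j%:Z) == t))%N = quadrant_count t.
Proof.
move=> t0 tM tN; apply: sum_stable2 => // i j H.
by rewrite quadrant_time_late //; move: H; lia.
Qed.

Lemma sum_pred1_cond (a M : nat) (b : bool) : (a < M)%N ->
  (\sum_(0 <= i < M) ((i == a) && b) = b)%N.
Proof.
case: b => aM; first by rewrite -[RHS](sum_pred1 aM); apply: eq_bigr => i _; rewrite andbT.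
by rewrite big1 // => i _; rewrite andbF.
Qed.

(** Dropping the axis loses only its cell of stage 2, by [wedge_time_col0]. *)
Lemma wedge_count_shift (t M N : nat) : (0 < t)%N -> (t <= M)%N -> (t <= N)%N ->
  (\sum_(0 <= i < M) \sum_(0 <= j < N) (wedge_time (i.+1%:Z, j.+1%:Z) == t)
   + (t == 2) = wedge_count t)%N.
Proof.
move=> t0 tM tN; rewrite -(wedge_countE t0 tM tN).
have := sum_shift (fun i => \sum_(0 <= j < N) (wedge_time (i%:Z, j.+1%:Z) == t))%N M.
rewrite [X in (_ + X = _ + _)%N -> _](_ : _ = nat_of_bool (t == 2)); last first.
  rewrite -(@sum_pred1_cond 0 N); last lia.
  apply: sum_eq => j _; rewrite wedge_time_col0; last lia.
  case: j => [|j]; first by rewrite /= eq_sym.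
  have -> : (j.+2%:Z == 1) = false by apply/eqP; lia.
  lia.
move=> ->; rewrite [X in (_ + X)%N]big1 ?addn0 // => j _.
by rewrite wedge_time_late //; lia.
Qed.

Lemma wedge_at_eq (k t : nat) (x y : int) : (0 < t <= 2 ^ k.+2)%N ->
  (wedge_at k (x, y) == t) = (wedge_time (x, y) == t).
Proof.
move=> Ht; case: (boolP ((`|x| < (2 ^ k.+2)%N%:Z) && (y < (2 ^ k.+2)%N%:Z))) => [H|H].
  by rewrite (@wedge_timeE k) //; lia.
rewrite wedge_time_late; [|lia|lia].
rewrite (w_out (wedge_atP k)); [by apply/eqP; lia|lia].
Qed.

Lemma quadrant_at_eq (k t : nat) (x y : int) : (0 < t <= 2 ^ k.+2)%N ->
  (quadrant_at k (x, y) == t) = (quadrant_time (x, y) == t).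
Proof.
move=> Ht; case: (boolP ((x < (2 ^ k.+2)%N%:Z) && (y < (2 ^ k.+2)%N%:Z))) => [H|H].
  by rewrite (@quadrant_timeE k) //; lia.
rewrite quadrant_time_late; [|lia|lia].
rewrite (q_out (quadrant_atP k)); [by apply/eqP; lia|lia].
Qed.

Lemma sh_eq (m t u : nat) : (0 < u)%N -> (sh m t == (m + u)%N) = (t == u).
Proof. by move=> u0; apply/eqP/eqP; shlia. Qed.

(** * Counts in the doubled patterns *)

Section Recurrences.
Variables k n : nat.
Hypothesis nE : n = (2 ^ k.+2)%N.
Let n4 : (4 <= n)%N. Proof. by rewrite nE (@leq_exp2l 2 2). Qed.
Let W : wedge n (wedge_at k). Proof. by rewrite nE; apply: wedge_atP. Qed.
Let V : quadrant n (wedge_at k) (quadrant_at k). Proof. by rewrite nE; apply: quadrant_atP. Qed.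

Let at_eq (t : nat) (x y : int) : (0 < t <= n)%N ->
  (wedge_at k (x, y) == t) = (wedge_time (x, y) == t).
Proof. by rewrite nE; apply: wedge_at_eq. Qed.

Let wedge_doubled (s : nat) (x y : int) : (0 < s <= n)%N ->
  (wedge_time (x, y) == (n + s)%N) = (dbl n (wedge_at k) (x, y) == (n + s)%N).
Proof. by move=> Hs; rewrite -(@wedge_at_eq k.+1) /= -?nE // expnS -nE; lia. Qed.

(** The new part of column 1 is the last column of an upward copy, whose only cell has value [n]. *)
Lemma ray_count_doubled (s : nat) : (0 < s <= n)%N -> ray_count (n + s) = (s == n).
Proof.
move=> Hs; rewrite -(@ray_countE (n + s) (2 * n)); [|lia|lia].
rewrite sum_double big_nat_cond big1 ?add0n; last first.
  move=> j /andP[/andP[_ Hj] _]; rewrite wedge_doubled // dbl_in; [|lia|lia].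
  by apply/eqP; rewrite eqb0; apply/eqP; have := w_le W 1 (j.+1%:Z); lia.
rewrite -(@sum_pred1_cond (n - 2) n (s == n)); last lia.
apply: sum_eq => j Hj; rewrite wedge_doubled // dbl_up; last lia.
have -> : (absz 1)%:Z - n%:Z = - (n%:Z - 1) by lia.
have -> : (n + j).+1%:Z - n%:Z = j.+1%:Z by lia.
rewrite (w_sym W) (w_last W) sh_eq; last lia.
have -> : (j.+1%:Z == n%:Z - 1) = (j == n - 2)%N by apply/eqP/eqP; lia.
case: (j == _) => /=; lia.
Qed.

(** The share of the rotated copy, whose delay [n - 1] accounts for [s.+1]. *)
Let side (s : nat) : nat :=
  (\sum_(0 <= i < n) \sum_(0 <= j < n) (wedge_at k ((n%:Z - 2 - j%:Z)%R, i.+1%:Z) == s.+1))%N.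

Let wedge_count_split (s : nat) : (0 < s <= n)%N ->
  (wedge_count (n + s) + (s == 2) = 2 * wedge_count s + side s)%N.
Proof.
move=> Hs; rewrite -(@wedge_countE (n + s) (2 * n) (2 * n)); [|lia|lia|lia].
rewrite (eq_bigr (fun i => \sum_(0 <= j < n) (wedge_time (i%:Z, j.+1%:Z) == (n + s)%N) +
   \sum_(0 <= j < n) (wedge_time (i%:Z, (n + j).+1%:Z) == (n + s)%N))%N); last first.
  by move=> i _; rewrite sum_double.
rewrite big_split /= !sum_double.
have -> : (\sum_(0 <= i < n) \sum_(0 <= j < n) (wedge_time (i%:Z, j.+1%:Z) == (n + s)%N) = 0)%N.
  rewrite big_nat_cond big1 // => i /andP[/andP[_ Hi] _].
  rewrite big_nat_cond big1 // => j /andP[/andP[_ Hj] _].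
  rewrite wedge_doubled // dbl_in; [|lia|lia].
  by apply/eqP; rewrite eqb0; apply/eqP; have := w_le W i (j.+1%:Z); lia.
have -> : (\sum_(0 <= i < n) \sum_(0 <= j < n)
    (wedge_time ((n + i)%N%:Z, j.+1%:Z) == (n + s)%N) = side s)%N.
  apply: sum_eq2 => i j Hi Hj; rewrite wedge_doubled // dbl_side; [|lia|lia].
  have -> : (n + s)%N = (n.-1 + s.+1)%N by lia.
  rewrite sh_eq //; congr (nat_of_bool (wedge_at _ (_, _) == _)); lia.
have -> : (\sum_(0 <= i < n) \sum_(0 <= j < n)
    (wedge_time ((n + i)%N%:Z, (n + j).+1%:Z) == (n + s)%N) = wedge_count s)%N.
  rewrite -(@wedge_countE s n n); [|lia|lia|lia].
  apply: sum_eq2 => i j Hi Hj; rewrite wedge_doubled // dbl_up; last lia.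
  rewrite sh_eq; last lia.
  by rewrite -at_eq //; congr (nat_of_bool (wedge_at _ (_, _) == _)); lia.
have : (\sum_(0 <= i < n) \sum_(0 <= j < n)
    (wedge_time (i%:Z, (n + j).+1%:Z) == (n + s)%N) + (s == 2) = wedge_count s)%N.
  rewrite -(@wedge_count_shift s n n); [|lia|lia|lia].
  congr addn; rewrite sum_rev.
  apply: sum_eq2 => i j Hi Hj; rewrite wedge_doubled // dbl_up; last lia.
  rewrite sh_eq; last lia.
  have -> : (absz (n - 1 - i)%N%:Z)%:Z - n%:Z = - i.+1%:Z by lia.
  rewrite (w_sym W) -at_eq //.
  by congr (nat_of_bool (wedge_at _ (_, _) == _)); lia.
lia.
Qed.

(** The columns kept run from -1 to [n - 2]. Column -1 mirrors the ray; the absent column [n - 1]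
    holds a single cell, of value [n], and this is the origin of the correction at
    [i = 2 ^ k - 1]. *)
Let side_split (s : nat) :
  (side s + (s.+1 == n) = \sum_(0 <= i < n) (wedge_at k (1%R, i.+1%:Z) == s.+1)
     + \sum_(0 <= j < n) \sum_(0 <= i < n) (wedge_at k (j%:Z, i.+1%:Z) == s.+1))%N.
Proof.
rewrite /side exchange_big /= sum_rev.
have -> : (\sum_(0 <= j < n) \sum_(0 <= i < n)
     (wedge_at k ((n%:Z - 2 - (n - 1 - j)%N%:Z)%R, i.+1%:Z) == s.+1) =
   \sum_(0 <= j < n) \sum_(0 <= i < n) (wedge_at k ((j%:Z - 1)%R, i.+1%:Z) == s.+1))%N.
  apply: sum_eq2 => j i Hj Hi; congr (nat_of_bool (wedge_at _ (_, _) == _)); lia.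
have En : n = n.-1.+1 by lia.
rewrite [in LHS]En big_nat_recl // -En sub0r.
rewrite (eq_bigr (fun i => nat_of_bool (wedge_at k (1%R, i.+1%:Z) == s.+1))); last first.
  by move=> i _; rewrite (w_sym W).
rewrite -addnA; congr addn.
rewrite [in RHS]En big_nat_recr //= -En; congr addn.
  by apply: sum_eq2 => j i Hj Hi; congr (nat_of_bool (wedge_at _ (_, _) == _)); lia.
rewrite -(@sum_pred1_cond (n - 2) n (s.+1 == n)); last lia.
apply: sum_eq => i Hi; have -> : n.-1%:Z = n%:Z - 1 by lia.
rewrite (w_last W).
have -> : (i.+1%:Z == n%:Z - 1) = (i == n - 2)%N by apply/eqP/eqP; lia.
by case: (i == _) => /=; lia.
Qed.

Lemma wedge_count_doubled (s : nat) : (0 < s < n)%N ->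
  (wedge_count (n + s) + (s == 2) + (s.+1 == n) =
   2 * wedge_count s + ray_count s.+1 + wedge_count s.+1)%N.
Proof.
move=> Hs; have := wedge_count_split (s := s) ltac:(lia); have := side_split s.
rewrite -(@ray_countE s.+1 n) // ; last lia.
rewrite -(@wedge_countE s.+1 n n) //; [|lia|lia].
rewrite (sum_eq (F := fun i => nat_of_bool (wedge_at k (1%R, i.+1%:Z) == s.+1))
  (G := fun i => nat_of_bool (wedge_time (1%R, i.+1%:Z) == s.+1))); last first.
  by move=> i _; rewrite at_eq //; lia.
rewrite (sum_eq2 (F := fun j i => nat_of_bool (wedge_at k (j%:Z, i.+1%:Z) == s.+1))
  (G := fun j i => nat_of_bool (wedge_time (j%:Z, i.+1%:Z) == s.+1))); last first.
  by move=> j i _ _; rewrite at_eq //; lia.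
lia.
Qed.

(** At stage [2 * n] the rotated copy, being one stage ahead, is exhausted. *)
Lemma wedge_count_doubled_last : (wedge_count (2 * n) = 2 * wedge_count n)%N.
Proof.
have := wedge_count_split (s := n) ltac:(lia); have := side_split n.
have late (x y : int) : (wedge_at k (x, y) == n.+1) = false.
  by apply/eqP; have := w_le W x y; lia.
rewrite big1 => [|i _]; last by rewrite late.
rewrite big1 => [|i _]; last by rewrite big1 // => j _; rewrite late.
have -> : (n + n = 2 * n)%N by lia.
lia.
Qed.

Lemma quadrant_count_doubled (s : nat) : (0 < s <= n)%N ->
  (quadrant_count (n + s) + 2 * (s == 2) = quadrant_count s + 2 * wedge_count s)%N.
Proof.
move=> Hs; rewrite -(@quadrant_countE (n + s) (2 * n) (2 * n)); [|lia|lia|lia].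
have E (x y : int) : (quadrant_time (x, y) == (n + s)%N) =
    (dblq n (wedge_at k) (quadrant_at k) (x, y) == (n + s)%N).
  by rewrite -(@quadrant_at_eq k.+1) /= -?nE // expnS -nE; lia.
rewrite (eq_bigr (fun i => \sum_(0 <= j < n) (quadrant_time (i%:Z, j%:Z) == (n + s)%N) +
   \sum_(0 <= j < n) (quadrant_time (i%:Z, (n + j)%N%:Z) == (n + s)%N))%N); last first.
  by move=> i _; rewrite sum_double.
rewrite big_split /= !sum_double.
have -> : (\sum_(0 <= i < n) \sum_(0 <= j < n) (quadrant_time (i%:Z, j%:Z) == (n + s)%N) = 0)%N.
  rewrite big_nat_cond big1 // => i /andP[/andP[_ Hi] _].
  rewrite big_nat_cond big1 // => j /andP[/andP[_ Hj] _].
  rewrite E /dblq; case: ifP; first lia; case: ifP; first lia.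
  by move=> _ _; apply/eqP; rewrite eqb0; apply/eqP; have := q_le V i j; lia.
have -> : (\sum_(0 <= i < n) \sum_(0 <= j < n)
    (quadrant_time ((n + i)%N%:Z, (n + j)%N%:Z) == (n + s)%N) = quadrant_count s)%N.
  rewrite -(@quadrant_countE s n n); [|lia|lia|lia].
  apply: sum_eq2 => i j Hi Hj; rewrite E /dblq; case: ifP; last lia; case: ifP; last lia.
  move=> _ _; rewrite sh_eq; last lia.
  rewrite -(@quadrant_at_eq k) -?nE //; congr (nat_of_bool (quadrant_at _ (_, _) == _)); lia.
(* A flanking wedge comes without its axis, which belongs to the corner copy; hence the correction
   at [s = 2]. *)
have up : (\sum_(0 <= i < n) \sum_(0 <= j < n)
    (quadrant_time (i%:Z, (n + j)%N%:Z) == (n + s)%N) + (s == 2) = wedge_count s)%N.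
  rewrite -(@wedge_count_shift s n n); [|lia|lia|lia].
  congr addn; rewrite sum_rev; apply: sum_eq => i Hi.
  have := sum_shift (fun j => nat_of_bool (wedge_time (i.+1%:Z, j%:Z) == s)) n.
  rewrite wedge_time_bot wedge_time_late; [|lia|lia].
  have -> : (nat_of_bool (i.+1%:Z == 0) == s) = false by case: eqP; lia.
  rewrite !addn0 => ->; apply: sum_eq => j Hj.
  rewrite E /dblq; case: ifP; first lia; case: ifP; last lia.
  move=> _ _; rewrite sh_eq; last lia.
  by rewrite -at_eq //; congr (nat_of_bool (wedge_at _ (_, _) == _)); lia.
have -> : (\sum_(0 <= i < n) \sum_(0 <= j < n)
    (quadrant_time ((n + i)%N%:Z, j%:Z) == (n + s)%N) =
    \sum_(0 <= i < n) \sum_(0 <= j < n)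
    (quadrant_time (i%:Z, (n + j)%N%:Z) == (n + s)%N))%N.
  rewrite exchange_big /=; apply: eq_bigr => i _; apply: eq_bigr => j _.
  by rewrite quadrant_time_sym.
lia.
Qed.

End Recurrences.

(** * Cell counts of the three automata *)

Lemma turned_on0 (allowed : pred cell) (seed : cell) : turned_on allowed seed 0 = 0%N.
Proof. by rewrite /turned_on /= fsetD0 cardfs0. Qed.

Lemma turned_on1 (allowed : pred cell) (seed : cell) : turned_on allowed seed 1 = 1%N.
Proof. by rewrite /turned_on /= fsetD0 cardfs1. Qed.

Lemma time1_turned_on (t : nat) (c : cell) : (0 < t)%N ->
  (c \in on_cells off_corner (0, 0) t `\` on_cells off_corner (0, 0) t.-1)%fset = (time1 c == t).
Proof.
apply: mem_turned_on => // [[x y] _|[x y] /pair_neq ne]; rewrite off_cornerE => H.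
  by apply: time1_good; lia.
rewrite /time1; case: ifP; first lia; case: ifP => // x0 _.
have -> : x = 0 by lia.
by rewrite wedge_time_bot; lia.
Qed.

Lemma time2_turned_on (t : nat) (c : cell) : (0 < t)%N ->
  (c \in on_cells off_corner (0, 1) t `\` on_cells off_corner (0, 1) t.-1)%fset = (time2 c == t).
Proof.
apply: mem_turned_on => // [[x y] _|[x y] /pair_neq ne]; rewrite off_cornerE => H.
  by apply: time2_good; lia.
rewrite /time2; case: ifP => y0; case: ifP => x0 //.
- lia.
- have -> : y - 1 = 0 by lia.
  by rewrite wedge_time_bot; lia.
- have -> : x = 0 by lia.
  by rewrite wedge_time_bot; lia.
Qed.

Lemma time_turned_on (c0 : cell) (t : nat) (c : cell) : (0 < t)%N ->
  (c \in on_cells xpredT c0 t `\` on_cells xpredT c0 t.-1)%fset =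
  (time (c.1 - c0.1, c.2 - c0.2) == t).
Proof.
case: c0 => a b.
apply: (@mem_turned_on xpredT (a, b) (fun c => time (c.1 - a, c.2 - b))) => //=.
  by rewrite !subrr.
move=> [x y] /pair_neq ne _.
have : good time (x - a, y - b) by apply: time_good; lia.
rewrite (good_transport (m := 0) (T' := fun c => time (c.1 - a, c.2 - b)) (c := (x, y))
  (motion_translation (- a) (- b))) //=; first shlia.
by move=> d _ /=; shlia.
Qed.

Lemma time1_up (x y : int) : 1 < y -> time1 (x, y) = sh 1 (wedge_time (x - 1, y - 1)).
Proof. by rewrite /time1 => ->. Qed.

Lemma time1_low (x y : int) : 0 <= x -> y <= 1 -> time1 (x, y) = wedge_time (y, x).
Proof. by move=> x0 y1; rewrite /time1 x0; case: ifP => //; lia. Qed.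

Lemma time1_off (x y : int) : x < 0 -> y <= 1 -> time1 (x, y) = 0%N.
Proof. by move=> x0 y1; rewrite /time1; case: ifP => ?; [lia|case: ifP => //; lia]. Qed.

(** Cut at [(1, 2)], the plane has two half wedges above that share one axis, a half wedge with its
    ray at the lower right, and only the seed at the lower left. The term at [s = 2] is the shared
    axis cell. *)
Lemma v1_count (s : nat) : (0 < s)%N ->
  (v1 s.+1 + (s == 2) = 2 * wedge_count s + wedge_count s.+1 + ray_count s.+1)%N.
Proof.
move=> s0; rewrite /v1 /turned_on.
pose M := (s + 3)%N.
rewrite (@card_folded _ (fun c => time1 c == s.+1) M 1 2); first last.
- move=> x y /eqP; rewrite /time1; case: ifP => y1.
    move=> E; have ne : wedge_time (@pair int int (x - 1) (y - 1)) <> 0%N by shlia.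
    have [] := wedge_time_range ne; move: E; shlia.
  case: ifP => // x0 E; have ne : wedge_time (y, x) <> 0%N by lia.
  have [] := wedge_time_range ne; lia.
- by move=> c; apply: time1_turned_on.
rewrite (sum_eq2 (G := fun i j => (wedge_time (i%:Z, j.+1%:Z) == s)
    + (wedge_time (i.+1%:Z, j.+1%:Z) == s) + (wedge_time ((1 - j%:Z)%R, i.+1%:Z) == s.+1))%N); last first.
  move=> i j _ _; rewrite !(@time1_up _ (2 + j%:Z)); [|lia|lia].
  rewrite -[s.+1]add1n !sh_eq // add1n.
  have -> : wedge_time (1 + i%:Z - 1, 2 + j%:Z - 1) = wedge_time (i%:Z, j.+1%:Z).
    by congr (wedge_time (_, _)); lia.
  have -> : wedge_time (1 - 1 - i%:Z - 1, 2 + j%:Z - 1) = wedge_time (i.+1%:Z, j.+1%:Z).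
    by rewrite -wedge_time_sym; congr (wedge_time (_, _)); lia.
  rewrite (@time1_low (1 + i%:Z)); [|lia|lia].
  have -> : wedge_time (2 - 1 - j%:Z, 1 + i%:Z) = wedge_time (1 - j%:Z, i.+1%:Z).
    by congr (wedge_time (_, _)); lia.
  case: (eqVneq i 0%N) => [->|i0]; last by rewrite time1_off ?addn0 //; lia.
  rewrite time1_low; [|lia|lia].
  rewrite (_ : 1 - 1 - 0%N%:Z = 0) // wedge_time_bot.
  by case: eqP => _; rewrite ?addn0 //; case: eqP; lia.
rewrite (eq_bigr (fun i => \sum_(0 <= j < M) (wedge_time (i%:Z, j.+1%:Z) == s)
    + \sum_(0 <= j < M) (wedge_time (i.+1%:Z, j.+1%:Z) == s)
    + \sum_(0 <= j < M) (wedge_time ((1 - j%:Z)%R, i.+1%:Z) == s.+1))%N); last first.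
  by move=> i _; rewrite !big_split.
rewrite !big_split /= (@wedge_countE s M M) //; try lia.
have := @wedge_count_shift s M M s0 ltac:(lia) ltac:(lia).
have -> : (\sum_(0 <= i < M) \sum_(0 <= j < M) (wedge_time ((1 - j%:Z)%R, i.+1%:Z) == s.+1) =
   ray_count s.+1 + wedge_count s.+1)%N.
  rewrite exchange_big /= {1}/M addnS big_nat_recl //.
  rewrite -(@ray_countE s.+1 M) // ?subr0; last lia.
  rewrite -(@wedge_countE s.+1 (s + 2) M) //; try lia.
  congr addn; apply: sum_eq2 => i j _ _; rewrite -wedge_time_sym.
  by congr (nat_of_bool (wedge_time (_, _) == _)); lia.
lia.
Qed.

Lemma time2_ne (x y : int) : 0 <= x -> 0 < y -> time2 (x, y) = quadrant_time (@pair int int x (y - 1)).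
Proof. by rewrite /time2 => -> ->. Qed.

Lemma time2_nw (x y : int) : x < 0 -> 0 < y -> time2 (x, y) = wedge_time (@pair int int x (y - 1)).
Proof. by move=> x0 y0; rewrite /time2 y0; case: ifP => //; lia. Qed.

Lemma time2_se (x y : int) : 0 <= x -> y <= 0 -> time2 (x, y) = wedge_time (@pair int int (1 - y) x).
Proof. by move=> x0 y0; rewrite /time2 x0; case: ifP => //; lia. Qed.

Lemma time2_off (x y : int) : x < 0 -> y <= 0 -> time2 (x, y) = 0%N.
Proof. by move=> x0 y0; rewrite /time2; case: ifP => ?; [lia|case: ifP => //; lia]. Qed.

(** Both half wedges lose their axis to the quadrant, whence twice the correction at stage 2. *)
Lemma v2_count (t : nat) : (0 < t)%N ->
  (v2 t + 2 * (t == 2) = quadrant_count t + 2 * wedge_count t)%N.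
Proof.
move=> t0; rewrite /v2 /turned_on.
pose M := t.+2.
rewrite (@card_folded _ (fun c => time2 c == t) M 0 1); first last.
- move=> x y /eqP; rewrite /time2; case: ifP => y1; case: ifP => x0 // E.
  + have ne : quadrant_time (@pair int int x (y - 1)) <> 0%N by lia.
    have [] := quadrant_time_range ne; move: E; lia.
  + have ne : wedge_time (@pair int int x (y - 1)) <> 0%N by lia.
    have [] := wedge_time_range ne; move: E; lia.
  + have ne : wedge_time (@pair int int (1 - y) x) <> 0%N by lia.
    have [] := wedge_time_range ne; move: E; lia.
  + lia.
- by move=> c; apply: time2_turned_on.
rewrite (sum_eq2 (G := fun i j => (quadrant_time (i%:Z, j%:Z) == t)
    + (wedge_time (i.+1%:Z, j%:Z) == t) + (wedge_time (j.+1%:Z, i%:Z) == t))%N); last first.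
  move=> i j _ _; rewrite (@time2_ne (0 + i%:Z)); [|lia|lia].
  rewrite (@time2_nw _ (1 + j%:Z)); [|lia|lia].
  rewrite (@time2_se (0 + i%:Z)); [|lia|lia].
  rewrite time2_off; [|lia|lia].
  have -> : quadrant_time (@pair int int (0 + i%:Z) (1 + j%:Z - 1)) = quadrant_time (i%:Z, j%:Z).
    by congr (quadrant_time (_, _)); lia.
  have -> : wedge_time (@pair int int (0 - 1 - i%:Z) (1 + j%:Z - 1)) = wedge_time (i.+1%:Z, j%:Z).
    by rewrite -wedge_time_sym; congr (wedge_time (_, _)); lia.
  have -> : wedge_time (@pair int int (1 - (1 - 1 - j%:Z)) (0 + i%:Z)) = wedge_time (j.+1%:Z, i%:Z).
    by congr (wedge_time (_, _)); lia.
  by case: eqP => // ?; lia.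
rewrite (eq_bigr (fun i => \sum_(0 <= j < M) (quadrant_time (i%:Z, j%:Z) == t)
    + \sum_(0 <= j < M) (wedge_time (i.+1%:Z, j%:Z) == t)
    + \sum_(0 <= j < M) (wedge_time (j.+1%:Z, i%:Z) == t))%N); last first.
  by move=> i _; rewrite !big_split.
rewrite !big_split /= (@quadrant_countE t M M) //; try lia.
have -> : (\sum_(0 <= i < M) \sum_(0 <= j < M) (wedge_time (j.+1%:Z, i%:Z) == t) =
   \sum_(0 <= i < M) \sum_(0 <= j < M) (wedge_time (i.+1%:Z, j%:Z) == t))%N.
  by rewrite exchange_big.
have -> : (\sum_(0 <= i < M) \sum_(0 <= j < M) (wedge_time (i.+1%:Z, j%:Z) == t) =
   \sum_(0 <= i < M) \sum_(0 <= j < t.+1) (wedge_time (i.+1%:Z, j.+1%:Z) == t))%N.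
  apply: eq_bigr => i _; rewrite /M big_nat_recl // wedge_time_bot.
  by have -> : (nat_of_bool (i.+1%:Z == 0) == t) = false by case: eqP; lia.
have := @wedge_count_shift t M t.+1 t0 ltac:(lia) ltac:(lia).
lia.
Qed.

(** Each of the four axis cells of stage 2 lies in two quadrants; stage 1 is left out because the
    seed lies in all four. *)
Lemma v_count (c0 : cell) (t : nat) : (1 < t)%N ->
  (v c0 t + 4 * (t == 2) = 4 * quadrant_count t)%N.
Proof.
move=> t1; rewrite /v /turned_on.
pose M := t.+1.
rewrite (@card_folded _ (fun c => time (c.1 - c0.1, c.2 - c0.2) == t) M c0.1 c0.2); first last.
- move=> x y /eqP; rewrite /time /= => E.
  move: E; set q := quadrant_time _ => E.
  have ne : q <> 0%N by lia.
  have [] := quadrant_time_range ne; rewrite -/q E; lia.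
- by move=> c; apply: time_turned_on; lia.
rewrite (sum_eq2 (G := fun i j => (quadrant_time (i%:Z, j%:Z) == t)
    + (quadrant_time (i.+1%:Z, j%:Z) == t) + (quadrant_time (i%:Z, j.+1%:Z) == t)
    + (quadrant_time (i.+1%:Z, j.+1%:Z) == t))%N); last first.
  move=> i j _ _; rewrite /time /=.
  by congr (_ + _ + _ + _)%N; congr (nat_of_bool (quadrant_time (_, _) == _)); lia.
rewrite (eq_bigr (fun i => \sum_(0 <= j < M) (quadrant_time (i%:Z, j%:Z) == t)
    + \sum_(0 <= j < M) (quadrant_time (i.+1%:Z, j%:Z) == t)
    + \sum_(0 <= j < M) (quadrant_time (i%:Z, j.+1%:Z) == t)
    + \sum_(0 <= j < M) (quadrant_time (i.+1%:Z, j.+1%:Z) == t))%N); last first.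
  by move=> i _; rewrite !big_split.
rewrite !big_split /= (@quadrant_countE t M M) //; try lia.
have t0 : (0 < t)%N by lia.
have axis (y : nat) : (quadrant_time (0%N%:Z, y%:Z) == t) = (y == 1) && (t == 2).
  rewrite quadrant_time_axis; case: y => [|[|y]] /=; lia.
have late (x y : int) : M%:Z <= x -> nat_of_bool (quadrant_time (x, y) == t) = 0%N.
  by move=> Hx; rewrite quadrant_time_late //; left; lia.
have shift (F : nat -> nat) :
  (\sum_(0 <= i < M) F i.+1 + F 0 = \sum_(0 <= i < M) F i + F M)%N := sum_shift F M.
have E1 : (\sum_(0 <= i < M) \sum_(0 <= j < M) (quadrant_time (i.+1%:Z, j%:Z) == t)
    + (t == 2) = quadrant_count t)%N.
  have := shift (fun i => \sum_(0 <= j < M) (quadrant_time (i%:Z, j%:Z) == t))%N.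
  rewrite (quadrant_countE (M := M) (N := M)) //; try lia.
  rewrite [X in (_ = _ + X)%N -> _]big1 => [|j _]; last exact: late.
  have -> : (\sum_(0 <= j < M) (quadrant_time (0%N%:Z, j%:Z) == t) = (t == 2))%N.
    by rewrite -(@sum_pred1_cond 1 M); [apply: eq_bigr => j _; rewrite axis|lia].
  by rewrite addn0.
have E2 : (\sum_(0 <= i < M) \sum_(0 <= j < M) (quadrant_time (i%:Z, j.+1%:Z) == t)
    + (t == 2) = quadrant_count t)%N.
  rewrite -E1 exchange_big /=; congr addn.
  by apply: eq_bigr => i _; apply: eq_bigr => j _; rewrite quadrant_time_sym.
have E3 : (\sum_(0 <= i < M) \sum_(0 <= j < M) (quadrant_time (i.+1%:Z, j.+1%:Z) == t)
    + (t == 2) = quadrant_count t - (t == 2))%N.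
  have := shift (fun i => \sum_(0 <= j < M) (quadrant_time (i%:Z, j.+1%:Z) == t))%N.
  rewrite [X in (_ = _ + X)%N -> _]big1 => [|j _]; last exact: late.
  have -> : (\sum_(0 <= j < M) (quadrant_time (0%N%:Z, j.+1%:Z) == t) = (t == 2))%N.
    by rewrite -(@sum_pred1_cond 0 M); [apply: eq_bigr => j _; rewrite axis|lia].
  lia.
(* This undoes the truncated subtraction in [E3]. *)
have : (2 * (t == 2) <= quadrant_count t)%N by lia.
lia.
Qed.

(** * Initial values and the final recurrences *)

Lemma small_wedge_count : [/\ wedge_count 1 = 0, wedge_count 2 = 2, wedge_count 3 = 2 & wedge_count 4 = 3]%N.
Proof. by rewrite /wedge_count unlock; vm_compute. Qed.

Lemma small_ray_count : [/\ ray_count 1 = 0, ray_count 2 = 1, ray_count 3 = 0 & ray_count 4 = 1]%N.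
Proof. by rewrite /ray_count unlock; vm_compute. Qed.

Lemma small_quadrant_count :
  [/\ quadrant_count 1 = 1, quadrant_count 2 = 3, quadrant_count 3 = 1 & quadrant_count 4 = 5]%N.
Proof. by rewrite /quadrant_count unlock; vm_compute. Qed.

(** The key identity: [wedge_count_doubled] and [v1_count] have the same right-hand side and the
    same correction at [s = 2]. *)
Lemma wedge_count_v1 (k s : nat) : (0 < s < 2 ^ k.+2)%N ->
  (wedge_count (2 ^ k.+2 + s) + (s.+1 == 2 ^ k.+2) = v1 s.+1)%N.
Proof.
move=> Hs; have := wedge_count_doubled (erefl (2 ^ k.+2)%N) Hs.
have := @v1_count s ltac:(lia); lia.
Qed.

Lemma wedge_count_pow (k : nat) : wedge_count (2 ^ k.+2) = (3 * 2 ^ k)%N.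
Proof.
elim: k => [|k IH]; first by have [] := small_wedge_count.
rewrite expnS (wedge_count_doubled_last (erefl (2 ^ k.+2)%N)) IH expnS; lia.
Qed.

Lemma small_v1 : [/\ v1 0 = 0, v1 1 = 1, v1 2 = 3, v1 3 = 5 & v1 4 = 8]%N.
Proof.
have [w1 w2 w3 w4] := small_wedge_count; have [r1 r2 r3 r4] := small_ray_count.
have V2 := @v1_count 1 isT; have V3 := @v1_count 2 isT; have V4 := @v1_count 3 isT.
split; [exact: turned_on0|exact: turned_on1|lia|lia|lia].
Qed.

Lemma small_v2 : [/\ v2 1 = 1, v2 2 = 5, v2 3 = 5 & v2 4 = 11]%N.
Proof.
have [w1 w2 w3 w4] := small_wedge_count; have [q1 q2 q3 q4] := small_quadrant_count.
have V1 := @v2_count 1 isT; have V2 := @v2_count 2 isT.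
have V3 := @v2_count 3 isT; have V4 := @v2_count 4 isT.
split; lia.
Qed.

Section Level.
Variable k : nat.
Let n := (2 ^ k.+2)%N.
Let n4 : (4 <= n)%N. Proof. by rewrite (@leq_exp2l 2 2). Qed.

(** This case is special because [v1_count] then involves [wedge_count] at [n] itself, which
    [wedge_count_v1] does not reach; the closed form at powers of two replaces it. *)
Lemma v1_pow_succ : v1 (n + 1) = (6 * 2 ^ k + 3)%N.
Proof.
have [_ _ E2 _ _] := small_v1.
have := @v1_count n ltac:(lia).
have := @wedge_count_v1 k 1 ltac:(lia); rewrite -/n E2.
have := @ray_count_doubled k n erefl 1 ltac:(lia).
have := wedge_count_pow k; rewrite -/n addn1; lia.
Qed.

Lemma v1_pow_add (i : nat) : (2 <= i < n)%N ->
  (v1 (n + i) + (i.+1 == n) = 2 * v1 i + v1 i.+1)%N.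
Proof.
case: i => [|i] // Hi.
have := @v1_count (n + i) ltac:(lia).
have := @wedge_count_v1 k i ltac:(lia); have := @wedge_count_v1 k i.+1 ltac:(lia).
have := @ray_count_doubled k n erefl i.+1 ltac:(lia).
rewrite -/n -addnS; lia.
Qed.

(** Here [6 * 2 ^ k] is [wedge_count (2 * n)], and the [1] subtracted is the end cell missing twice,
    less the ray cell of stage [2 * n]. *)
Lemma v1_pow_double : v1 (2 * n) = (2 * v1 n + 6 * 2 ^ k - 1)%N.
Proof.
have := @v1_count (2 * n).-1 ltac:(lia).
have := @wedge_count_v1 k n.-1 ltac:(lia).
have := @ray_count_doubled k n erefl n ltac:(lia).
have := wedge_count_doubled_last (erefl n); have := wedge_count_pow k; rewrite -/n.
have -> : (n + n.-1 = (2 * n).-1)%N by lia.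
have -> : (n + n = 2 * n)%N by lia.
have -> : (2 * n).-1.+1 = (2 * n)%N by lia.
have -> : n.-1.+1 = n by lia.
rewrite eqxx; lia.
Qed.

Lemma v2_pow_add (i : nat) : (0 < i < n)%N ->
  (v2 (n + i) + 2 * (i.+1 == n) = v2 i + 2 * v1 i.+1)%N.
Proof.
move=> Hi; have := @v2_count (n + i) ltac:(lia); have := @v2_count i ltac:(lia).
have := @quadrant_count_doubled k n erefl i ltac:(lia).
have := @wedge_count_v1 k i ltac:(lia); rewrite -/n; lia.
Qed.

Lemma v2_pow_double : v2 (2 * n) = (v2 n + 12 * 2 ^ k)%N.
Proof.
have := @v2_count (2 * n) ltac:(lia); have := @v2_count n ltac:(lia).
have := @quadrant_count_doubled k n erefl n ltac:(lia).
have := wedge_count_doubled_last (erefl n); have := wedge_count_pow k; rewrite -/n.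
have -> : (n + n = 2 * n)%N by lia.
lia.
Qed.

(** The case [i = n] is included because it gives the value at the next power of two. *)
Lemma v_pow_add (c0 : cell) (i : nat) : (0 < i <= n)%N -> v c0 (n + i) = (4 * v2 i)%N.
Proof.
move=> Hi; have := @v_count c0 (n + i) ltac:(lia); have := @v2_count i ltac:(lia).
have := @quadrant_count_doubled k n erefl i ltac:(lia); lia.
Qed.

End Level.

Lemma v1_pow (k : nat) : v1 (2 ^ k.+2) = ((3 * k + 7) * 2 ^ k + 1)%N.
Proof.
elim: k => [|k IH]; first by have [] := small_v1.
rewrite expnS v1_pow_double IH expnS; nia.
Qed.

Lemma v2_pow (k : nat) : (v2 (2 ^ k.+1) + 1 = 6 * 2 ^ k)%N.
Proof.
have [_ E2 _ E4] := small_v2.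
elim: k => [|k IH]; first by rewrite E2.
case: k IH => [|k] IH; first by rewrite E4.
rewrite expnS v2_pow_double; move: IH; rewrite !expnS; lia.
Qed.

Theorem theorem12 :
  [/\ v1 0 = 0%N, v1 1 = 1%N, v1 2 = 3%N, v1 3 = 5%N &
    forall k : nat, (2 <= k)%N ->
    [/\ v1 (2 ^ k + 0) = ((3 * k + 1) * 2 ^ (k - 2) + 1)%N,
        v1 (2 ^ k + 1) = (3 * 2 ^ (k - 1) + 3)%N,
        forall i : nat, (2 <= i <= 2 ^ k - 2)%N ->
          v1 (2 ^ k + i) = (2 * v1 i + v1 (i + 1))%N &
        forall i : nat, i = (2 ^ k - 1)%N ->
          (v1 (2 ^ k + i))%:Z = 2 * (v1 i)%:Z + (v1 (i + 1))%:Z - 1]]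
  /\
  [/\ v2 0 = 0%N, v2 1 = 1%N &
    forall k : nat, (1 <= k)%N ->
    [/\ (v2 (2 ^ k + 0))%:Z = 3 * 2 ^+ k - 1,
        forall i : nat, (1 <= i <= 2 ^ k - 2)%N ->
          v2 (2 ^ k + i) = (v2 i + 2 * v1 (i + 1))%N &
        forall i : nat, i = (2 ^ k - 1)%N ->
          (v2 (2 ^ k + i))%:Z = (v2 i)%:Z + 2 * (v1 (i + 1))%:Z - 2]]
  /\
  (forall c0 : int * int,
    [/\ v c0 0 = 0%N, v c0 1 = 1%N &
      forall k : nat, (1 <= k)%N ->
        (v c0 (2 ^ k + 0))%:Z = 6 * 2 ^+ k - 4 /\
        forall i : nat, (1 <= i <= 2 ^ k - 1)%N ->
          v c0 (2 ^ k + i) = (4 * v2 i)%N]).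
Proof.
have [V10 V11 V12 V13 _] := small_v1; have [V21 V22 V23 _] := small_v2.
have n4 k : (4 <= 2 ^ k.+2)%N by rewrite (@leq_exp2l 2 2).
have powz k : (2 : int) ^+ k = (2 ^ k)%N%:Z by elim: k => [|k IH] //; rewrite exprS IH expnS PoszM.
split; last split.
- split=> // -[|[|k]] // _; split.
  + rewrite addn0 v1_pow subn2 /=; congr (_ * _ + _)%N; lia.
  + rewrite v1_pow_succ subn1 /= expnS; lia.
  + move=> i Hi; rewrite addn1; have := @v1_pow_add k i ltac:(lia).
    have -> : (i.+1 == 2 ^ k.+2)%N = false by apply/eqP; have := n4 k; lia.
    by rewrite addn0.
  + move=> i ->; have := @v1_pow_add k (2 ^ k.+2 - 1) ltac:(have := n4 k; lia).
    have -> : ((2 ^ k.+2 - 1).+1 == 2 ^ k.+2)%N by apply/eqP; have := n4 k; lia.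
    rewrite addn1; lia.
- split; [exact: turned_on0|exact: V21|].
  move=> [|k] // _; split.
  + rewrite addn0 powz; have := v2_pow k; rewrite expnS; lia.
  + case: k => [|k] i Hi; first by move: Hi; lia.
    rewrite addn1; have := @v2_pow_add k i ltac:(lia).
    have -> : (i.+1 == 2 ^ k.+2)%N = false by apply/eqP; have := n4 k; lia.
    by rewrite addn0.
  (* Doubling starts at size 4, so the power [2 ^ 1] is settled by the initial values. *)
  + move=> i ->; case: k => [|k]; first by rewrite V23 V21 V12.
    have := @v2_pow_add k (2 ^ k.+2 - 1) ltac:(have := n4 k; lia).
    have -> : ((2 ^ k.+2 - 1).+1 == 2 ^ k.+2)%N by apply/eqP; have := n4 k; lia.
    rewrite addn1; lia.
- have [q1 q2 q3 q4] := small_quadrant_count.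
  move=> c0; split; [exact: turned_on0|exact: turned_on1|].
  move=> [|k] // _; rewrite addn0 powz.
  have V2 := @v_count c0 2 isT; have V3 := @v_count c0 3 isT; have V4 := @v_count c0 4 isT.
  case: k => [|k]; split.
  + by rewrite expn1; lia.
  + move=> i Hi; have -> : i = 1%N by lia.
    by rewrite V21 (_ : 2 ^ 1 + 1 = 3)%N //; lia.
  + case: k => [|k]; first by rewrite (_ : 2 ^ 2 = 4)%N //; lia.
    have -> : (2 ^ k.+3 = 2 ^ k.+2 + 2 ^ k.+2)%N by rewrite [LHS]expnS; lia.
    rewrite v_pow_add; last by have := n4 k; lia.
    have := v2_pow k.+1; rewrite !expnS; lia.
  + by move=> i Hi; apply: v_pow_add; have := n4 k; lia.
Qed.
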